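(* Let $\Bbbk$ be a countable, algebraically closed field. There exists a (non-unital) associative $\Bbbk$-algebra $A$ which is positively graded, $A=\bigoplus_{i\ge 1}A_i$, finitely generated in degree one (i.e. generated as a $\Bbbk$-algebra by finitely many elements of $A_1$), nil, and which admits a point module. Consequently, the Köthe Conjecture is false: there exists an associative ring (not necessarily unital) having two nil left ideals whose sum is not nil.
   Context: Algebras and rings are associative and not necessarily unital. A ring (or one-sided ideal) is nil if each of its elements is nilpotent. For a positively graded $\Bbbk$-algebra $A=\bigoplus_{i\ge1}A_i$ generated by $A_1$, a point module over $A$ is a graded right $A$-module $M=\bigoplus_{i\ge 0}M_i$ (so $M_iA_j\subseteq M_{i+j}$) such that $\dim_{\Bbbk}M_i=1$ for every $i\ge 0$ and $M$ is generated in degree zero, i.e. $M=M_0+M_0A$; equivalently, $M_iA_1=M_{i+1}$ for all $i\ge0$. The Köthe Conjecture asserts that the sum of any two nil left ideals of a ring is again nil. *)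

(* Defs.v *)
From HB Require Import structures.
From mathcomp Require Import all_boot all_order all_algebra.
From mathcomp Require Import boolp.

Set Implicit Arguments.
Unset Strict Implicit.
Unset Printing Implicit Defensive.

Import GRing.Theory.
Local Open Scope ring_scope.

(* The rings of ssralg are unital, so a non-unital ring is built as an additive
   group that is also a semigroup. Its product is therefore the semigroup
   product of group_scope, written (x * y)%g, whereas 0 and + are those of
   ring_scope. *)
HB.mixin Record Zmodule_Semigroup_isNonUnitalRing R
    of GRing.Zmodule R & Semigroup R := {
  nu_mulDl : forall x y z : R, ((x + y)%R * z)%g = (x * z)%g + (y * z)%g;
  nu_mulDr : forall x y z : R, (x * (y + z)%R)%g = (x * y)%g + (x * z)%g
}.

#[short(type="nuRingType")]
HB.structure Definition NonUnitalRing :=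
  { R of Zmodule_Semigroup_isNonUnitalRing R & GRing.Zmodule R & Semigroup R }.

HB.mixin Record Lmodule_NonUnitalRing_isNonUnitalAlgebra (K : comNzRingType) A
    of GRing.Lmodule K A & NonUnitalRing A := {
  nu_scaleAl : forall (c : K) (x y : A), c *: (x * y)%g = ((c *: x) * y)%g;
  nu_scaleAr : forall (c : K) (x y : A), c *: (x * y)%g = (x * (c *: y))%g
}.

#[short(type="nuAlgType")]
HB.structure Definition NonUnitalAlgebra (K : comNzRingType) :=
  { A of Lmodule_NonUnitalRing_isNonUnitalAlgebra K A
       & GRing.Lmodule K A & NonUnitalRing A }.

Section NonUnitalRings.
Variable R : nuRingType.

(* iter n (fun y => x * y) x is x^(n+1): there is no unit to start from. *)
Definition nilpotent_elt (x : R) : Prop :=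
  exists n : nat, iter n (fun y => (x * y)%g) x = 0.

Definition nil_on (S : {pred R}) : Prop := {in S, forall x, nilpotent_elt x}.

Definition left_ideal (I : {pred R}) : Prop :=
  zmod_closed I /\ (forall r x : R, x \in I -> (r * x)%g \in I).

Definition ideal_sum (I J : {pred R}) : {pred R} :=
  [pred x | `[< exists y z, [/\ y \in I, z \in J & x = y + z] >]].

End NonUnitalRings.

(* The K-module V is the internal direct sum of the submodules V_ i, i >= d. *)
Definition direct_sum_from (K : fieldType) (V : lmodType K) (d : nat)
    (V_ : nat -> {pred V}) : Prop :=
  [/\ forall i, (d <= i)%N -> submod_closed (V_ i),
      forall x : V, exists (n : nat) (f : nat -> V),
        (forall i, (d <= i < n)%N -> f i \in V_ i) /\ x = \sum_(d <= i < n) f i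
    & forall (n : nat) (f : nat -> V),
        (forall i, (d <= i < n)%N -> f i \in V_ i) ->
        \sum_(d <= i < n) f i = 0 ->
        forall i, (d <= i < n)%N -> f i = 0].

Section NonUnitalAlgebras.
Variables (K : fieldType) (A : nuAlgType K).

Definition positive_grading (A_ : nat -> {pred A}) : Prop :=
  direct_sum_from 1 A_ /\
  (forall i j : nat, (0 < i)%N -> (0 < j)%N ->
   forall x y : A, x \in A_ i -> y \in A_ j -> (x * y)%g \in A_ (i + j)%N).

Definition subalgebra (S : {pred A}) : Prop := submod_closed S /\ mulg_closed S.

Definition generated_by (s : seq A) : Prop :=
  forall S : {pred A}, subalgebra S -> {subset s <= S} -> forall x, x \in S.

Definition fin_gen_degree_one (A_ : nat -> {pred A}) : Prop :=
  exists s : seq A, {subset s <= A_ 1%N} /\ generated_by s.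

Record right_action (M : lmodType K) (act : M -> A -> M) : Prop := RightAction {
  act_linear_l : forall a : A, linear (fun m => act m a);
  act_linear_r : forall m : M, linear (act m);
  actM : forall (m : M) (a b : A), act m (a * b)%g = act (act m a) b
}.

Definition one_dimensional (M : lmodType K) (S : {pred M}) : Prop :=
  exists e : M, [/\ e \in S, e != 0 & forall m, m \in S -> exists c : K, m = c *: e].

Record point_module (A_ : nat -> {pred A}) (M : lmodType K)
    (act : M -> A -> M) (M_ : nat -> {pred M}) : Prop := PointModule {
  point_right_action : right_action act;
  point_direct_sum : direct_sum_from 0 M_;
  point_graded : forall i j : nat, (0 < j)%N ->
    forall (m : M) (a : A), m \in M_ i -> a \in A_ j -> act m a \in M_ (i + j)%N;
  point_dim : forall i : nat, one_dimensional (M_ i);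
  (* M = M_0 + M_0 A, where M_0 A consists of the finite sums of products. *)
  point_generated : forall m : M, exists (m0 : M) (s : seq (M * A)),
    [/\ m0 \in M_ 0%N, {in s, forall u, u.1 \in M_ 0%N}
      & m = m0 + \sum_(u <- s) act u.1 u.2]
}.

Definition admits_point_module (A_ : nat -> {pred A}) : Prop :=
  exists (M : lmodType K) (act : M -> A -> M) (M_ : nat -> {pred M}),
    point_module A_ act M_.

End NonUnitalAlgebras.

(* Main.v *)
(** Let [X c], for [c < 3], be the weighted shifts [e_i |-> zeta_i(c) e_(i+1)] with
    nonzero vectors [zeta_i] of [K^3]. The algebra A that they generate is graded by
    the diagonals, and the span of the [e_i] is a point module over it.

    An element [a] of A involving words of length at most [d] acts through [d * d]
    transfer matrices over [K[X]], and [a] is nilpotent as soon as a product of them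
    over some window vanishes and that window recurs with bounded gaps. Such a window
    is found by lowering the rank of the product one unit at a time: between two windows
    of rank at most r+1 insert a long stretch of free vectors and kill an
    (r+1) * (r+1) determinant. Each transfer matrix depends on X through a rank one
    term, so this determinant has about as many coefficients as the stretch has
    positions, whereas each free vector, taken to be a product of two linear forms,
    varies in a product of two projective lines. The coefficients are forms of
    multidegree (r+1, .., r+1), hence have a common zero as long as there are fewer
    of them than lines: by the Nullstellensatz they would otherwise generate all forms of
    large multidegree, against a dimension count. A window costs only finitely many
    positions in a long period, so countably many elements can be treated in turn.

    For the second part, if [p(t) = X 0 t + X 1 t^2 + X 2 t^3], then [e_0 p(t)^n] never
    vanishes because K[t] is a domain. Hence the companion matrix of [1 - p(t)] is not
    nilpotent; its cube lies in the ring of 3 * 3 matrices over A, which is the sum of its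
    three column left ideals, each of which is nil because A is. *)
Require Import Defs.
From HB Require Import structures.
From mathcomp Require Import all_boot all_order all_algebra.
From mathcomp Require Import boolp classical_sets functions mpoly algC.
From mathcomp Require Import zify ring.

Set Implicit Arguments.
Unset Strict Implicit.
Unset Printing Implicit Defensive.

Import GRing.Theory.
Local Open Scope ring_scope.

(** * Nullstellensatz *)

Section Ideals.
Variable R : comNzRingType.
Implicit Types (I P : R -> Prop) (x y f : R).

Record is_ideal I : Prop := IsIdeal {
  ideal0 : I 0;
  idealD : forall x y, I x -> I y -> I (x + y);
  idealMl : forall x y, I y -> I (x * y)
}.

Record is_prime P : Prop := IsPrime {
  prime_is_ideal : is_ideal P;
  prime_proper : ~ P 1;
  primeM : forall x y, P (x * y) -> P x \/ P y
}.

Lemma idealB I : is_ideal I -> forall x y, I x -> I y -> I (x - y).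
Proof.
by move=> iI x y Ix Iy; rewrite -mulN1r; apply: idealD => //; apply: idealMl.
Qed.

Lemma ideal_sumr I : is_ideal I -> forall (T : Type) (r : seq T) (Q : pred T) F,
  (forall i, Q i -> I (F i)) -> I (\sum_(i <- r | Q i) F i).
Proof.
by move=> iI T r Q F IF; apply: big_ind => //; [apply: ideal0 | apply: idealD].
Qed.

Lemma primeX P : is_prime P -> forall x n, P (x ^+ n) -> P x.
Proof.
move=> pP x; elim=> [|n IHn]; first by rewrite expr0 => /(prime_proper pP).
by rewrite exprS => /(primeM pP) [].
Qed.

Definition add_ideal I x : R -> Prop := fun y => exists a b, I b /\ y = a * x + b.

Lemma add_idealP I x : is_ideal I ->
  [/\ is_ideal (add_ideal I x), add_ideal I x x & forall y, I y -> add_ideal I x y].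
Proof.
move=> iI; split; last by move=> y Iy; exists 0, y; rewrite mul0r add0r.
- split; first by exists 0, 0; rewrite mul0r addr0; split=> //; apply: ideal0.
  + move=> _ _ [a [b [Ib ->]]] [c [d [Id ->]]]; exists (a + c), (b + d).
    by split; [apply: idealD | ring].
  + move=> z _ [a [b [Ib ->]]]; exists (z * a), (z * b).
    by split; [apply: idealMl | ring].
- by exists 1, 0; rewrite mul1r addr0; split=> //; apply: ideal0.
Qed.

(** An ideal maximal among those that contain [I] and no power of [f] is prime: adjoining [x] or [y]
    from outside brings in powers of [f], whose product lies in the ideal as soon as [x * y]
    does. *)
Lemma prime_avoiding I f : is_ideal I -> (forall n, ~ I (f ^+ n)) ->
  exists P, [/\ is_prime P, forall x, I x -> P x & ~ P f].
Proof.
move=> iI nIf.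
pose good (J : R -> Prop) :=
  [/\ is_ideal J, forall x, I x -> J x & forall n, ~ J (f ^+ n)].
pose T := {J : R -> Prop | good J}.
have goodI : good I by [].
pose le (J J' : T) : bool := `[< forall x, sval J x -> sval J' x >].
have [||||[P gP] maxP] := @Zorn T le.
- by move=> J; apply/asboolP.
- by move=> J1 J2 J3 /asboolP h1 /asboolP h2; apply/asboolP => x /h1 /h2.
- move=> [J1 g1] [J2 g2] /asboolP /= h1 /asboolP /= h2.
  have e : J1 = J2 by apply/funext => x; apply/propext; split; [apply: h1 | apply: h2].
  by subst J2; congr exist; apply: Prop_irrelevance.
- move=> C Ctot.
  have [[J0 CJ0]|C0] := pselect (exists J, C J); last first.
    by exists (exist _ I goodI) => J CJ; case: C0; exists J.
  pose U x := exists J : T, C J /\ sval J x.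
  have gU : good U.
    split; first split.
    + by exists J0; split=> //; case: J0 {CJ0} => J [[]].
    + move=> x y [J1 [C1 J1x]] [J2 [C2 J2y]].
      have [/asboolP h|/asboolP h] := Ctot _ _ C1 C2.
      * by exists J2; split=> //; case: (svalP J2) => iJ _ _; apply: idealD => //; apply: h.
      * by exists J1; split=> //; case: (svalP J1) => iJ _ _; apply: idealD => //; apply: h.
    + move=> x y [J [CJ Jy]]; exists J; split=> //.
      by case: (svalP J) => iJ _ _; apply: idealMl.
    + by move=> x Ix; exists J0; split=> //; case: (svalP J0) => _ h _; apply: h.
    + by move=> n [J [CJ Jf]]; case: (svalP J) => _ _ /(_ n).
  by exists (exist _ U gU) => J CJ; apply/asboolP => x Jx; exists J.
have [iP IP nPf] := gP.
have big x : ~ P x -> exists n, add_ideal P x (f ^+ n).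
  move=> nPx; apply: contrapT => nf; have [iA Ax PA] := add_idealP x iP.
  have gA : good (add_ideal P x).
    split=> // [y /IP /PA //|n Af]; first by apply: nf; exists n.
  have /(congr1 sval) /= e := maxP (exist _ _ gA) (asboolT (PA : forall y, sval (exist _ P gP) y -> _)).
  by apply: nPx; rewrite -e.
exists P; split=> //; last by move=> Pf; apply: (nPf 1%N); rewrite expr1.
split=> //; first by move=> P1; apply: (nPf 0%N); rewrite expr0.
move=> x y Pxy; apply: contrapT => /not_orP [/big [n [a [b [Pb ea]]]] /big [m [c [d [Pd ec]]]]].
apply: (nPf (n + m)%N); rewrite exprD ea ec.
have -> : (a * x + b) * (c * y + d) = (a * c) * (x * y) + ((a * x + b) * d + (c * y) * b).
  by ring.
by apply: idealD => //; [|apply: idealD]; try apply: idealMl.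
Qed.

End Ideals.

Section Nullstellensatz.
Variable K : closedFieldType.

(** The Nullstellensatz for the [K]-algebra [R], stated for a prime and an element outside it so
    that it passes from [R] to [{poly R}]. *)
Definition has_points (R : comNzRingType) (iota : K -> R) : Prop :=
  forall P f, is_prime P -> ~ P f ->
  exists phi : {rmorphism R -> K},
    [/\ forall c, phi (iota c) = c, forall x, P x -> phi x = 0 & phi f != 0].

Lemma has_points_base : has_points (idfun : K -> K).
Proof.
move=> P f pP nPf; exists idfun; split=> //= [x Px|].
  apply/eqP/negP => /negP x0; case: (prime_proper pP).
  by rewrite -(mulVf x0); apply: (idealMl (prime_is_ideal pP)).
by apply/eqP => f0; apply: nPf; rewrite f0; apply: (ideal0 (prime_is_ideal pP)).
Qed.

Section PrimeOfPoly.
Variables (R : idomainType) (P : {poly R} -> Prop).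
Hypothesis pP : is_prime P.

Definition contraction c := P c%:P.
Local Notation Q := contraction.
Definition coefs_in (h : {poly R}) := forall i, Q h`_i.

Let iP := prime_is_ideal pP.

Lemma contraction_prime : is_prime Q.
Proof.
split; first split.
- by rewrite /Q; apply: (ideal0 iP).
- by move=> x y; rewrite /Q polyCD; apply: idealD.
- by move=> x y; rewrite /Q polyCM; apply: idealMl.
- exact: (prime_proper pP).
- by move=> x y; rewrite /Q polyCM; apply: (primeM pP).
Qed.
Let iQ := prime_is_ideal contraction_prime.

Lemma coefs_inW h : coefs_in h -> P h.
Proof.
move=> Qh; rewrite -[h]coefK poly_def; apply: ideal_sumr => // i _.
by rewrite -mul_polyC mulrC; apply: idealMl => //; apply: Qh.
Qed.

(** Modulo Q, [g] plays the generator of [J] over the fraction field of R/Q, which is thus never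
    built. Were its leading coefficient in [Q], its leading term would lie in [P], hence in [J], and
    could be dropped. *)
Lemma min_size_lead (J : {poly R} -> Prop) h0 : is_ideal J -> (forall x, P x -> J x) ->
  J h0 -> ~ coefs_in h0 ->
  exists g, [/\ J g, ~ Q (lead_coef g) &
    forall h, J h -> (size h < size g)%N -> coefs_in h].
Proof.
move=> iJ PJ Jh0 nQh0.
pose p n := `[< exists g, [/\ J g, ~ coefs_in g & size g = n] >].
have ex_p : exists n, p n by exists (size h0); apply/asboolP; exists h0.
have [n /asboolP [g [Jg nQg sg]] minn] := ex_minnP ex_p.
have min_g h : J h -> (size h < size g)%N -> coefs_in h.
  move=> Jh lt_h; apply: contrapT => nQh.
  have /minn : p (size h) by apply/asboolP; exists h.
  by rewrite -sg leqNgt lt_h.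
exists g; split=> // Ql.
have gn0 : g != 0 by apply/eqP => g0; apply: nQg => i; rewrite g0 coef0; apply: (ideal0 iQ).
have sg_gt0 : (0 < size g)%N by rewrite size_poly_gt0.
pose t := lead_coef g *: 'X^((size g).-1).
have Qt : coefs_in t by move=> i; rewrite coefZ coefXn mulrC; apply: idealMl.
apply: nQg => i; have : coefs_in (g - t).
  apply: min_g; first by apply: idealB => //; apply: PJ; apply: coefs_inW.
  rewrite -[X in (_ < X)%N](prednK sg_gt0) ltnS; apply/leq_sizeP => j hj.
  rewrite coefB coefZ coefXn; have [->|ne] := eqVneq j (size g).-1.
    by rewrite mulr1 subrr.
  by rewrite mulr0 subr0 nth_default // -(prednK sg_gt0) ltn_neqAle eq_sym ne.
by move=> /(_ i) Qgt; have := idealD iQ Qgt (Qt i); rewrite coefB subrK.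
Qed.

End PrimeOfPoly.

(** Let Q be the contraction of [P]. If P = Q[X], take a point of Q at which a coefficient of [f]
    survives, then a non-root of the image of [f]. Otherwise [g] generates [P] generically and is
    irreducible modulo Q, so the gcd [h] of [f] and [g] is a constant outside Q. Take a point of Q
    at which both leading coefficients survive, then a root of the image of [g]: as [h] is a
    multiple of [f] plus an element of [P], the image of [f] cannot vanish there. *)
Lemma has_points_poly (R : idomainType) (iota : K -> R) :
  has_points iota -> has_points (fun c => (iota c)%:P).
Proof.
move=> ptR P f pP nPf; have iP := prime_is_ideal pP.
have pQ := contraction_prime pP; have iQ := prime_is_ideal pQ.
have [all_coefs|] := pselect (forall h, P h -> coefs_in P h).
  have [i nQi] : exists i, ~ contraction P f`_i.
    by apply/existsNP => Qf; apply: nPf; apply: coefs_inW.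
  have [phi [phi_iota phiQ phif]] := ptR _ _ pQ nQi.
  have : map_poly phi f != 0.
    by apply/eqP => /polyP /(_ i) /eqP; rewrite coef_map coef0 (negPf phif).
  move=> /closed_nonrootP [x nroot].
  exists (horner_eval x \o map_poly phi); split=> [c|h Ph|]; rewrite /= /horner_eval.
  - by rewrite map_polyC hornerC /= phi_iota.
  - have -> : map_poly phi h = 0.
      by apply/polyP => j; rewrite coef_map coef0; apply/phiQ/all_coefs.
    by rewrite horner0.
  - exact: nroot.
move=> /existsNP [h0 /not_implyP [Ph0 nQh0]].
have [g [Pg nQg min_g]] := min_size_lead pP iP (fun _ => id) Ph0 nQh0.
have [iJ Jf PJ] := add_idealP f iP.
have nQf : ~ coefs_in P f by move=> /(coefs_inW pP).
have [h [Jh nQh min_h]] := min_size_lead pP iJ PJ Jf nQf.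
have nQX c n : ~ contraction P c -> ~ contraction P (c ^+ n) by move=> nQc /(primeX pQ).
have nz k : ~ contraction P (lead_coef k) -> k != 0.
  by move=> nQk; apply/eqP => k0; apply: nQk; rewrite k0 lead_coef0; apply: (ideal0 iQ).
(* The remainder of a pseudo-division stays in [J] and is shorter than [l], hence lies in Q[X]. *)
have pdiv (J : {poly R} -> Prop) k l : is_ideal J -> J k -> J l ->
    ~ contraction P (lead_coef l) ->
    (forall k, J k -> (size k < size l)%N -> coefs_in P k) ->
    exists c, [/\ ~ contraction P c, coefs_in P (k %% l) & c *: k = (k %/ l) * l + k %% l].
  move=> iJ' Jk Jl nQl min_l; exists (lead_coef l ^+ scalp k l).
  split; [exact: nQX | apply: (min_l) | exact: Pdiv.Idomain.divp_eq].
    have := Pdiv.Idomain.divp_eq k l => /eqP; rewrite addrC -subr_eq => /eqP <-.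
    by apply: idealB => //; [rewrite -mul_polyC; apply: idealMl | apply: idealMl].
  by rewrite Pdiv.CommonIdomain.ltn_modp; apply: nz.
have PZ c k : ~ contraction P c -> P (c *: k) -> P k.
  by move=> nQc; rewrite -mul_polyC => /(primeM pP) [].
(* Up to scalars outside Q and modulo Q[X], [h] divides [f] and [g]. If it were not constant,
   primality would put into [P] either [g %/ h], which is shorter than [g], or [h] and then [f]. *)
have sh1 : size h = 1%N.
  apply/eqP; rewrite eqn_leq size_poly_gt0 nz // andbT leqNgt; apply/negP => sh_gt1.
  have le_hg : (size h <= size g)%N.
    rewrite leqNgt; apply/negP => lt_gh; apply: nQg; exact: (min_h _ (PJ _ Pg) lt_gh).
  have [c [nQc Qs eg]] := pdiv _ g h iJ (PJ _ Pg) Jh nQh min_h.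
  have : P ((g %/ h) * h).
    have -> : g %/ h * h = c *: g - g %% h by rewrite eg addrK.
    by apply: idealB (coefs_inW pP Qs) => //; rewrite -mul_polyC; apply: idealMl.
  move=> /(primeM pP) [Pq|Ph].
    have Qq : coefs_in P (g %/ h).
      by apply: min_g => //; rewrite size_divp ?nz //; lia.
    have : contraction P (c * lead_coef g).
      rewrite lead_coefE -coefZ eg coefD; apply: idealD => //.
      by rewrite coefM; apply: ideal_sumr => // i _; rewrite mulrC; apply: idealMl.
    by case/(primeM pQ).
  have [c' [nQc' Qs' ef]] := pdiv _ f h iJ Jf Jh nQh min_h.
  by apply: nPf; apply: (PZ c') => //; rewrite ef; apply: idealD (coefs_inW pP Qs') => //; apply: idealMl.
have eh : h = (lead_coef h)%:P by rewrite [LHS]size1_polyC ?sh1 // lead_coefE sh1.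
have [phi [phi_iota phiQ phi_nz]] : exists phi : {rmorphism R -> K},
    [/\ forall c, phi (iota c) = c, forall x, contraction P x -> phi x = 0 &
        phi (lead_coef g * lead_coef h) != 0].
  by apply: ptR => // /(primeM pQ) [].
move: phi_nz; rewrite rmorphM mulf_eq0 negb_or => /andP [phig phih].
have sg : size (map_poly phi g) = size g by rewrite size_map_poly_id0.
have [x xroot] : exists x, root (map_poly phi g) x.
  apply/closed_rootP; rewrite sg; apply/negP => /eqP sg1; apply: nQg.
  by rewrite /contraction lead_coefE sg1 -size1_polyC ?sg1.
pose ev : {rmorphism {poly R} -> K} := horner_eval x \o map_poly phi.
have evE k : ev k = (map_poly phi k).[x] by [].
have evC c : ev c%:P = phi c by rewrite evE map_polyC hornerC.
have evQ k : coefs_in P k -> ev k = 0.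
  move=> Qk; rewrite evE; have -> : map_poly phi k = 0.
    by apply/polyP => j; rewrite coef_map coef0; apply: phiQ.
  by rewrite horner0.
have evP k : P k -> ev k = 0.
  move=> Pk.
  have Qs : coefs_in P (k %% g).
    by have [c []] := pdiv _ k g iP Pk Pg nQg min_g.
  have /(congr1 ev) := Pdiv.Idomain.divp_eq k g.
  rewrite -mul_polyC rmorphM rmorphD rmorphM (evQ _ Qs) evC.
  rewrite [ev g](eqP xroot) mulr0 addr0 rmorphXn => /eqP.
  by rewrite mulf_eq0 expf_eq0 (negPf phig) andbF => /eqP.
exists ev; split=> // [c|]; first by rewrite evC.
apply/negP => /eqP evf; have [u [p [Pp eh']]] := Jh.
by move: phih; rewrite -evC -eh eh' rmorphD rmorphM evf mulr0 add0r (evP _ Pp) eqxx.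
Qed.
End Nullstellensatz.

(** Primes can be pulled back along any ring morphism, so a surjection from an iterated univariate
    polynomial ring replaces an isomorphism. Variables beyond the [n]-th are sent to 0. *)
Lemma poly_ring_covers_mpoly (K : closedFieldType) n k :
  exists (R : idomainType) (iota : {rmorphism K -> R}) (psi : {rmorphism R -> {mpoly K[n]}}),
    [/\ has_points iota, forall c, psi (iota c) = c%:MP &
        forall i : 'I_n, (i < k)%N -> exists x, psi x = 'X_i].
Proof.
elim: k => [|k [R [iota [psi [ptR psiC psiX]]]]].
  by exists K, idfun, (@mpolyC n K); split=> //; apply: has_points_base.
pose u : {mpoly K[n]} := if insub k is Some i then 'X_i else 0.
have cu : commr_rmorph psi u by move=> x; apply: mulrC.
exists {poly R}, (polyC \o iota), (horner_morph cu); split.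
- exact: has_points_poly.
- by move=> c; rewrite /= /horner_morph map_polyC hornerC /= psiC.
- move=> i; rewrite ltnS leq_eqVlt => /orP [/eqP ik|/psiX [x <-]]; last first.
    by exists x%:P; rewrite /= /horner_morph map_polyC hornerC.
  by exists 'X; rewrite /= /horner_morph map_polyX hornerX /u -ik valK.
Qed.

(** A prime over [I] that avoids the powers of [f] is pulled back to the iterated polynomial ring.
    The point found there kills the kernel of [psi], hence is the evaluation at the values of the
    lifted variables. *)
Lemma nullstellensatz (K : closedFieldType) n (I : {mpoly K[n]} -> Prop) f :
  is_ideal I -> (forall k, ~ I (f ^+ k)) ->
  exists v : 'I_n -> K, (forall p, I p -> p.@[v] = 0) /\ f.@[v] != 0.
Proof.
move=> iI nIf; have [P [pP IP nPf]] := prime_avoiding iI nIf.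
have [R [iota [psi [ptR psiC psiX]]]] := poly_ring_covers_mpoly K n n.
have lift (p : {mpoly K[n]}) : exists x, psi x = p.
  elim/mpolyind: p => [|c m p _ _ [x <-]]; first by exists 0; rewrite rmorph0.
  suff [y <-] : exists y, psi y = 'X_[m].
    by exists (iota c * y + x); rewrite rmorphD rmorphM psiC mul_mpolyC.
  have /choice [y ey] : forall i : 'I_n, exists y, psi y = 'X_i by move=> i; apply: psiX.
  exists (\prod_i y i ^+ m i); rewrite rmorph_prod mpolyXE_id.
  by apply: eq_bigr => i _; rewrite rmorphXn ey.
have pR : is_prime (P \o psi).
  have [iP nP1 PM] := pP; split; first split.
  - by rewrite /= rmorph0; apply: ideal0.
  - by move=> x y /=; rewrite rmorphD; apply: idealD.
  - by move=> x y /=; rewrite rmorphM; apply: idealMl.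
  - by rewrite /= rmorph1.
  - by move=> x y /=; rewrite rmorphM; apply: PM.
have [f' ef'] := lift f.
have [|phi [phiC phiP phif]] := ptR _ f' pR; first by rewrite /= ef'.
have /choice [y ey] : forall i : 'I_n, exists y, psi y = 'X_i by move=> i; apply: psiX.
have phiE x : phi x = (psi x).@[phi \o y].
  have [x' ex' phix'] : exists2 x', psi x' = psi x & phi x' = (psi x).@[phi \o y].
    elim/mpolyind: (psi x) => [|c m p _ _ [z <- ez]].
      by exists 0; rewrite ?rmorph0 ?meval0.
    exists (iota c * \prod_i y i ^+ m i + z).
      rewrite rmorphD rmorphM psiC mul_mpolyC rmorph_prod [in RHS]mpolyXE_id.
      by congr (_ *: _ + _); apply: eq_bigr => i _; rewrite rmorphXn ey.
    rewrite rmorphD rmorphM phiC ez mevalD mevalZ mevalX rmorph_prod.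
    by congr (_ * _ + _); apply: eq_bigr => i _; rewrite rmorphXn.
  rewrite -phix'; apply/eqP; rewrite -subr_eq0 -rmorphB; apply/eqP/phiP => /=.
  by rewrite rmorphB ex' subrr; apply: (ideal0 (prime_is_ideal pP)).
exists (phi \o y); split=> [p /IP Pp|]; last by rewrite -ef' -phiE.
by have [x ex] := lift p; rewrite -ex -phiE phiP //= ex.
Qed.

(** * Common zeros of multihomogeneous forms *)

Lemma dependent_of_small_span (K : fieldType) (V : lmodType K) (S T : finType)
    (x : S -> V) (b : T -> V) :
  (#|T| < #|S|)%N -> (forall s, exists c : T -> K, x s = \sum_t c t *: b t) ->
  exists v : S -> K, (exists s, v s != 0) /\ \sum_s v s *: x s = 0.
Proof.
move=> ltTS /choice [c ec].
pose A : 'M[K]_(#|S|, #|T|) := \matrix_(i, j) c (enum_val i) (enum_val j).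
have /rowV0Pn [w /sub_kermxP wA /rV0Pn [i wi]] : kermx A != 0.
  rewrite -mxrank_eq0 mxrank_ker subn_eq0 -ltnNge.
  by apply: leq_ltn_trans (rank_leq_col _) ltTS.
exists (fun s => w 0 (enum_rank s)); split.
  by exists (enum_val i); rewrite enum_valK.
under eq_bigr do rewrite ec scaler_sumr.
rewrite exchange_big big1 // => t _ /=.
under eq_bigr do rewrite scalerA.
rewrite -scaler_suml; suff -> : \sum_s w 0 (enum_rank s) * c s t = 0 by rewrite scale0r.
have /rowP /(_ (enum_rank t)) := wA; rewrite !mxE => wAt.
rewrite (reindex (@enum_val S predT)) /=; last by apply: onW_bij; apply: enum_val_bij.
by rewrite -[RHS]wAt; apply: eq_bigr => j _; rewrite mxE enum_valK enum_rankK.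
Qed.

Section MultiHomogeneous.
Variables (K : closedFieldType) (q : nat).
Local Notation S := {mpoly K[q + q]}.

(** The variables [lshift q i] and [rshift q i] are homogeneous coordinates on the [i]-th of [q]
    projective lines. *)
Definition pair_deg (m : 'X_{1..q + q}) (i : 'I_q) : nat :=
  (m (lshift q i) + m (rshift q i))%N.

Lemma pair_degD m1 m2 i : pair_deg (m1 + m2)%MM i = (pair_deg m1 i + pair_deg m2 i)%N.
Proof. by rewrite /pair_deg !mnmDE; lia. Qed.

Definition has_pair_degs e (m : 'X_{1..q + q}) := [forall i, pair_deg m i == e].

Definition multihomog e (p : S) := {in msupp p, forall m, has_pair_degs e m}.

Definition multihomog_part e (p : S) : S :=
  \sum_(m <- msupp p | has_pair_degs e m) p@_m *: 'X_[m].

Lemma multihomog_partP e p : multihomog e (multihomog_part e p).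
Proof.
move=> m; rewrite /multihomog_part => /msupp_sum_le /flattenP /= [s].
case/mapP => m'; rewrite mem_filter => /andP [hm' _] -> /msuppZ_le.
by rewrite msuppX inE => /eqP ->.
Qed.

Lemma multihomog_partB e p :
  {in msupp (p - multihomog_part e p), forall m, ~~ has_pair_degs e m}.
Proof.
move=> m; rewrite mcoeff_msupp; apply: contraNN => hm.
rewrite mcoeffB raddf_sum /= big_mkcond /=.
under eq_bigr => m' _ do rewrite mcoeffZ mcoeffX.
have [mp|nmp] := boolP (m \in msupp p).
  rewrite (bigD1_seq m) ?msupp_uniq //= hm eqxx mulr1 big1 ?addr0 ?subrr //.
  by move=> m' /negPf ne; rewrite ne mulr0 if_same.
rewrite big1_seq ?subr0; first by rewrite memN_msupp_eq0.
by move=> m' /andP [_ mp']; case: eqP => [e'|_]; [rewrite -e' mp' in nmp | rewrite mulr0 if_same].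
Qed.

Lemma multihomog0 e : multihomog e 0.
Proof. by move=> m; rewrite msupp0. Qed.

Lemma multihomogD e p1 p2 : multihomog e p1 -> multihomog e p2 -> multihomog e (p1 + p2).
Proof. by move=> h1 h2 m /msuppD_le; rewrite mem_cat => /orP [/h1|/h2]. Qed.

Lemma multihomogN e p : multihomog e p -> multihomog e (- p).
Proof. by move=> h m; rewrite (perm_mem (msuppN _)) => /h. Qed.

Lemma multihomog_sum e (I : Type) (s : seq I) (Q : pred I) F :
  (forall i, Q i -> multihomog e (F i)) -> multihomog e (\sum_(i <- s | Q i) F i).
Proof. by move=> h; apply: big_ind => //; [apply: multihomog0 | apply: multihomogD]. Qed.

Lemma multihomogM e1 e2 p1 p2 :
  multihomog e1 p1 -> multihomog e2 p2 -> multihomog (e1 + e2)%N (p1 * p2).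
Proof.
move=> h1 h2 m /msuppM_le /allpairsP [[m1 m2] /= [/h1 /forallP k1 /h2 /forallP k2 ->]].
by apply/forallP => i; rewrite pair_degD (eqP (k1 i)) (eqP (k2 i)).
Qed.

Lemma multihomog_same_part0 e p : multihomog e p ->
  {in msupp p, forall m, ~~ has_pair_degs e m} -> p = 0.
Proof.
move=> h1 h2; apply/mpolyP => m; rewrite mcoeff0.
have [mp|] := boolP (m \in msupp p); last by move/memN_msupp_eq0.
by have := h2 m mp; rewrite h1.
Qed.

Definition gen_ideal n (g : 'I_n -> S) (p : S) : Prop :=
  exists h : 'I_n -> S, p = \sum_j g j * h j.

Lemma gen_ideal_is_ideal n (g : 'I_n -> S) : is_ideal (gen_ideal g).
Proof.
split.
- by exists (fun=> 0); rewrite big1 // => j _; rewrite mulr0.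
- move=> _ _ [h ->] [k ->]; exists (fun j => h j + k j).
  by rewrite -big_split; apply: eq_bigr => j _; rewrite mulrDr.
- move=> x _ [h ->]; exists (fun j => x * h j).
  by rewrite mulr_sumr; apply: eq_bigr => j _; rewrite mulrCA.
Qed.

(** Truncate the cofactors to multidegree [e]. The error consists of monomials of multidegree
    [r + e], but also comes from cofactor terms of other multidegrees, so it is zero. *)
Lemma gen_ideal_multihomog n (g : 'I_n -> S) r e p :
  (forall j, multihomog r (g j)) -> multihomog (r + e)%N p -> gen_ideal g p ->
  exists h : 'I_n -> S, (forall j, multihomog e (h j)) /\ p = \sum_j g j * h j.
Proof.
move=> hg hp [h ep]; exists (fun j => multihomog_part e (h j)).
split=> [j|]; first exact: multihomog_partP.
apply/eqP; rewrite -subr_eq0; apply/eqP; apply: (@multihomog_same_part0 (r + e)%N).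
  apply: multihomogD => //; apply: multihomogN; apply: multihomog_sum => j _.
  by apply: multihomogM => //; apply: multihomog_partP.
rewrite ep -sumrB => m /msupp_sum_le /flattenP /= [s].
case/mapP => j _ ->; rewrite -mulrBr => /msuppM_le /allpairsP [[m1 m2] /= [/hg h1 /multihomog_partB h2 ->]].
apply: contraNN h2 => /forallP h12; apply/forallP => i.
by have := h12 i; rewrite pair_degD (eqP (forallP h1 i)) eqn_add2l.
Qed.

End MultiHomogeneous.

Section CommonZero.
Variables (K : closedFieldType) (q n r : nat).
Local Notation S := {mpoly K[q + q]}.
Variable g : 'I_n -> S.
Hypothesis g_hom : forall j, multihomog r (g j).

(** A point has a non-zero coordinate in every pair exactly when some product of one variable per
    pair does not vanish there. *)
Definition pair_choice (k : {ffun 'I_q -> bool}) (i : 'I_q) : 'I_(q + q) :=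
  if k i then rshift q i else lshift q i.

Lemma mpolyX_pairs (m : 'X_{1..q + q}) :
  'X_[m] = \prod_i ('X_(lshift q i) ^+ m (lshift q i) * 'X_(rshift q i) ^+ m (rshift q i)) :> S.
Proof. by rewrite mpolyXE_id big_split_ord big_split. Qed.

(** Since [2 * D <= e], one of the two exponents in each pair is at least [D]. *)
Lemma pair_monomial_in_ideal D e m :
  (forall k, gen_ideal g ((\prod_i 'X_(pair_choice k i)) ^+ D)) ->
  (2 * D <= e)%N -> has_pair_degs e m -> gen_ideal g 'X_[m].
Proof.
move=> gD le_De /forallP hm; have iI := gen_ideal_is_ideal g.
pose k : {ffun 'I_q -> bool} := [ffun i => (D <= m (rshift q i))%N].
suff [p ->] : exists p : S, 'X_[m] = p * (\prod_i 'X_(pair_choice k i)) ^+ D by apply: (idealMl iI).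
pose f (i : 'I_q) : S := if k i
  then 'X_(lshift q i) ^+ m (lshift q i) * 'X_(rshift q i) ^+ (m (rshift q i) - D)
  else 'X_(lshift q i) ^+ (m (lshift q i) - D) * 'X_(rshift q i) ^+ m (rshift q i).
exists (\prod_i f i); rewrite mpolyX_pairs -prodrXl -big_split; apply: eq_bigr => i _.
have := eqP (hm i); rewrite /f /pair_choice /pair_deg ffunE.
case: ifP => hi hd; first by rewrite /= -mulrA -exprD subnK.
by rewrite /= mulrAC -exprD subnK //; lia.
Qed.

(** Bounding the exponents one by one, and not their sum, gives [N.+1 ^ n] products of the [g j],
    which is sharp enough for the count below. *)
Definition weighted_span N e (p : S) : Prop :=
  exists h : {ffun 'I_n -> 'I_N.+1} -> S,
    (forall b, multihomog e (h b)) /\ p = \sum_(b : {ffun 'I_n -> 'I_N.+1}) (\prod_j g j ^+ b j) * h b.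

Lemma weighted_spanD N e p1 p2 :
  weighted_span N e p1 -> weighted_span N e p2 -> weighted_span N e (p1 + p2).
Proof.
move=> [h1 [hh1 ->]] [h2 [hh2 ->]]; exists (fun b => h1 b + h2 b).
split=> [b|]; first exact: multihomogD.
by rewrite -big_split; apply: eq_bigr => b _; rewrite mulrDr.
Qed.

Lemma weighted_span_term N e (b : {ffun 'I_n -> 'I_N.+1}) h :
  multihomog e h -> weighted_span N e ((\prod_j g j ^+ b j) * h).
Proof.
move=> hh; exists (fun b' => if b' == b then h else 0).
split=> [b'|]; first by case: ifP => // _; apply: multihomog0.
by rewrite (bigD1 b) //= eqxx [X in _ + X]big1 ?addr0 // => b' /negPf ->; rewrite mulr0.
Qed.

Lemma weighted_span_sum N e (I : Type) (s : seq I) F :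
  (forall i, weighted_span N e (F i)) -> weighted_span N e (\sum_(i <- s) F i).
Proof.
move=> h; apply: big_ind => //; last by apply: weighted_spanD.
by exists (fun=> 0); split=> [b|]; [apply: multihomog0 | rewrite big1 // => b _; rewrite mulr0].
Qed.

Lemma weighted_span_step N e j p : weighted_span N e p -> weighted_span N.+1 e (g j * p).
Proof.
move=> [h [hh ->]]; rewrite mulr_sumr; apply: weighted_span_sum => b.
pose b' : {ffun 'I_n -> 'I_N.+2} := [ffun i => inord (b i + (i == j))].
suff -> : g j * (\prod_i g i ^+ b i * h b) = (\prod_i g i ^+ b' i) * h b.
  exact: weighted_span_term.
rewrite mulrA; congr (_ * _).
have eb i : b' i = (b i + (i == j))%N :> nat.
  by rewrite ffunE inordK //; have := ltn_ord (b i); case: (i == j); lia.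
under [RHS]eq_bigr do rewrite eb exprD.
rewrite big_split /= mulrC; congr (_ * _).
by rewrite (bigD1 j) //= eqxx expr1 big1 ?mulr1 // => i /negPf ->; rewrite expr0.
Qed.

(** Each expansion along the [g j] lowers the multidegree of the cofactors by [r], and can be
    repeated as long as they are known to lie in the ideal. *)
Lemma multihomog_weighted_span d N p :
  (forall e p, (d <= e)%N -> multihomog e p -> gen_ideal g p) ->
  multihomog (r * N + d)%N p -> weighted_span N d p.
Proof.
move=> gI; elim: N p => [|N IHN] p hp.
  have -> : p = (\prod_j g j ^+ ([ffun=> ord0] : {ffun 'I_n -> 'I_1}) j) * p.
    by rewrite big1 ?mul1r // => j _; rewrite ffunE expr0.
  by apply: weighted_span_term; rewrite muln0 add0n in hp.
have [||h [hh ->]] := @gen_ideal_multihomog K q n g r (r * N + d)%N p g_hom.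
- by rewrite addnA -mulnS.
- by apply: gI hp; rewrite leq_addl.
by apply: weighted_span_sum => j; apply: weighted_span_step; apply: IHN.
Qed.

Definition pair_monomial d (t : {ffun 'I_q -> 'I_d.+1}) e : 'X_{1..q + q} :=
  [multinom match fintype.split i with inl a => t a : nat | inr a => (e - t a)%N end | i < q + q].

Lemma pair_monomialL d t e i : @pair_monomial d t e (lshift q i) = t i.
Proof. by rewrite mnmE (unsplitK (inl i)). Qed.

Lemma pair_monomialR d t e i : @pair_monomial d t e (rshift q i) = (e - t i)%N.
Proof. by rewrite mnmE (unsplitK (inr i)). Qed.

Lemma pair_monomial_degs d t e : (d <= e)%N -> has_pair_degs e (@pair_monomial d t e).
Proof.
move=> le_de; apply/forallP => i.
rewrite /pair_deg pair_monomialL pair_monomialR subnKC //.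
by rewrite (leq_trans _ le_de) // -ltnS.
Qed.

Lemma pair_monomial_inj d e : injective (fun t => @pair_monomial d t e).
Proof.
move=> t1 t2 e12; apply/ffunP => i; apply: val_inj => /=.
by rewrite -(pair_monomialL t1 e) e12 pair_monomialL.
Qed.

Lemma multihomog_expand d p : multihomog d p ->
  exists c : {ffun 'I_q -> 'I_d.+1} -> K, p = \sum_t c t *: 'X_[pair_monomial t d].
Proof.
move=> hp; exists (fun t => p@_(pair_monomial t d)); apply/mpolyP => m.
rewrite raddf_sum /=; under eq_bigr do rewrite mcoeffZ mcoeffX.
have [mp|nmp] := boolP (m \in msupp p); last first.
  rewrite memN_msupp_eq0 // big1 // => t _; case: eqP => [->|_]; last by rewrite mulr0.
  by rewrite memN_msupp_eq0 ?mul0r.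
have /forallP hm := hp m mp.
pose t : {ffun 'I_q -> 'I_d.+1} := [ffun i => inord (m (lshift q i))].
have et i : t i = m (lshift q i) :> nat.
  by rewrite ffunE inordK // ltnS -(eqP (hm i)) leq_addr.
have em : m = pair_monomial t d.
  apply/mnmP => i; case: (split_ordP i) => a ->.
    by rewrite pair_monomialL et.
  by rewrite pair_monomialR et -(eqP (hm a)) /pair_deg addKn.
rewrite (bigD1 t) //= -em eqxx mulr1 big1 ?addr0 // => t' /eqP ne.
by case: eqP => [e'|_]; rewrite ?mulr0 //; case: ne; apply: (@pair_monomial_inj d d); rewrite e' em.
Qed.

Theorem multihomog_common_zero : (0 < r)%N -> (n < q)%N ->
  exists v : 'I_(q + q) -> K, (forall j, (g j).@[v] = 0) /\
    forall i, (v (lshift q i) != 0) || (v (rshift q i) != 0).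
Proof.
move=> r_gt0 lt_nq; apply: contrapT => nov; have iI := gen_ideal_is_ideal g.
(* A common zero of the [g j] at which a choice product survives would be a point as sought, so the
   Nullstellensatz puts a power of every choice product into the ideal. *)
have [D gD] : exists D, forall k, gen_ideal g ((\prod_i 'X_(pair_choice k i)) ^+ D).
  have /choice [D hD] : forall k, exists D, gen_ideal g ((\prod_i 'X_(pair_choice k i)) ^+ D).
    move=> k; apply: contrapT => /forallNP nD; have [v [vg vk]] := nullstellensatz iI nD.
    apply: nov; exists v; split=> [j|i].
      apply: vg; exists (fun j' => (j' == j)%:R).
      by rewrite (bigD1 j) //= eqxx mulr1 big1 ?addr0 // => j' /negPf ->; rewrite mulr0.
    move: vk; rewrite rmorph_prod /= => /prodf_neq0 /(_ i isT).
    by rewrite mevalXU /pair_choice; case: ifP => _ ->; rewrite ?orbT.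
  exists (\max_k D k) => k; rewrite -(subnK (leq_bigmax k)) exprD.
  exact: (idealMl iI).
pose d := (2 * D)%N.
have gI e p : (d <= e)%N -> multihomog e p -> gen_ideal g p.
  move=> le_de hp; rewrite [p]mpolyE big_seq; apply: (ideal_sumr iI) => m mp.
  by rewrite -mul_mpolyC; apply: (idealMl iI); apply: pair_monomial_in_ideal gD le_de (hp m mp).
(* Multidegree [e] has at least [N.+1 ^ q] monomials, while its forms are spanned by
   [N.+1 ^ n * d.+1 ^ q] products. This is [N.+1 ^ n * N], less than [N.+1 ^ n.+1], which is at most
   [N.+1 ^ q]. *)
pose N := (d.+1 ^ q)%N; pose e := (r * N + d)%N.
have le_Ne : (N <= e)%N by rewrite /e; nia.
pose b (u : {ffun 'I_n -> 'I_N.+1} * {ffun 'I_q -> 'I_d.+1}) : S :=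
  (\prod_j g j ^+ u.1 j) * 'X_[pair_monomial u.2 d].
have [||v [[t vt] vX]] := @dependent_of_small_span K S {ffun 'I_q -> 'I_N.+1} _
    (fun t => 'X_[pair_monomial t e]) b.
- rewrite card_prod !card_ffun !card_ord.
  apply: (@leq_trans (N.+1 ^ n.+1)); last by rewrite leq_pexp2l.
  by rewrite expnSr ltn_pmul2l ?expn_gt0.
- move=> t.
  have /(multihomog_weighted_span gI) [h [hh ->]] : multihomog e ('X_[pair_monomial t e] : S).
    by move=> m; rewrite msuppX inE => /eqP ->; apply: pair_monomial_degs.
  have /choice [c ec] := fun b => multihomog_expand (hh b).
  exists (fun u => c u.1 u.2); rewrite -(pair_bigA _ (fun b' t' => c b' t' *: b (b', t'))) /=.
  apply: eq_bigr => b' _; rewrite [in LHS]ec mulr_sumr; apply: eq_bigr => t' _.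
  by rewrite -scalerAr.
move/(congr1 (mcoeff (pair_monomial t e))): vX; rewrite raddf_sum mcoeff0 /=.
under eq_bigr do rewrite mcoeffZ mcoeffX.
rewrite (bigD1 t) //= eqxx mulr1 big1 ?addr0; first by move/eqP; rewrite (negPf vt).
by move=> t' /eqP ne; case: eqP => [/pair_monomial_inj|]; rewrite ?mulr0.
Qed.

End CommonZero.

(** * Transfer matrices *)

Definition ncpoly (K : Type) := seq (K * seq 'I_3).

Section Transfer.
Variables (K : Type) (R : comNzRingType) (iota : K -> R).
Implicit Types (s : ncpoly K) (Z : nat -> 'rV[R]_3).

(** The coefficient by which the word [w] sends e_i to e_(i + size w), along the path [Z]. *)
Fixpoint word_weight Z i (w : seq 'I_3) : R :=
  if w is c :: w' then Z i 0 c * word_weight Z i.+1 w' else 1.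

Lemma word_weight_cat Z i w1 w2 :
  word_weight Z i (w1 ++ w2) = word_weight Z i w1 * word_weight Z (i + size w1)%N w2.
Proof.
elim: w1 i => [|c w1 IHw] i /=; first by rewrite mul1r addn0.
by rewrite IHw mulrA addSnnS.
Qed.

(** The entry (i, m) of the matrix by which [s] acts on the e_i. The coefficients of [s] stay in [K]
    while [Z] may live over a larger ring, so that paths can be symbolic. *)
Definition weight s Z i m : R :=
  \sum_(u <- s | (i + size u.2 == m)%N) iota u.1 * word_weight Z i u.2.

Lemma eq_word_weight Z Z' i i' w :
  (forall k, (k < size w)%N -> Z (i + k)%N = Z' (i' + k)%N) ->
  word_weight Z i w = word_weight Z' i' w.
Proof.
elim: w i i' => //= c w IHw i i' eZ; have := eZ 0%N isT; rewrite !addn0 => ->.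
by congr (_ * _); apply: IHw => k lt_k; rewrite !addSnnS; apply: eZ.
Qed.

Lemma eq_weight s Z Z' p p' a b :
  (forall k, (a <= k < b)%N -> Z (p + k)%N = Z' (p' + k)%N) ->
  weight s Z (p + a)%N (p + b)%N = weight s Z' (p' + a)%N (p' + b)%N.
Proof.
move=> eZ; rewrite /weight; apply: eq_big => u; first by rewrite -!addnA !eqn_add2l.
move=> /eqP e; congr (_ * _); apply: eq_word_weight => k lt_k.
by rewrite -!addnA; apply: eZ; lia.
Qed.

Variables (s : ncpoly K) (d : nat).

Definition shift_mx : 'M[{poly R}]_d := \matrix_(a, b) (a == b.+1 :> nat)%:R.
Definition last_row : 'rV[{poly R}]_d := \row_b (b.+1 == d)%:R.
Definition weight_col Z m : 'cV[{poly R}]_d := \col_a (weight s Z (m + a)%N (m + d)%N)%:P.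

(* For a strictly upper triangular matrix a with a i m = weight s Z i m and steps
   at most d, the series G = (1 - X a)^-1 satisfies
   (G i (m+1), .., G i (m+d)) = (G i m, .., G i (m+d-1)) *m companion Z m. *)
Definition companion Z m : 'M[{poly R}]_d :=
  shift_mx + 'X *: (weight_col Z m *m last_row).

Lemma companionE Z m a b : companion Z m a b =
  (a == b.+1 :> nat)%:R + (b.+1 == d)%:R * ('X * (weight s Z (m + a)%N (m + d)%N)%:P).
Proof. by rewrite !mxE big_ord1 !mxE; congr (_ + _); ring. Qed.

Fixpoint transfer Z p l : 'M[{poly R}]_d :=
  if l is l'.+1 then transfer Z p l' *m companion Z (p + l')%N else 1%:M.

Lemma transferD Z p l1 l2 :
  transfer Z p (l1 + l2)%N = transfer Z p l1 *m transfer Z (p + l1)%N l2.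
Proof.
elim: l2 => [|l2 IHl]; first by rewrite addn0 mulmx1.
by rewrite addnS /= IHl mulmxA addnA.
Qed.

(** Companion factors look ahead by at most [d], so a window of length [l] reads no position beyond
    the first [l + d]. *)
Lemma eq_transfer Z Z' p p' l :
  (forall k, (k < l + d)%N -> Z (p + k)%N = Z' (p' + k)%N) ->
  transfer Z p l = transfer Z' p' l.
Proof.
elim: l => //= l IHl eZ; rewrite IHl => [|k lt_k]; last by apply: eZ; lia.
congr (_ *m _); apply/matrixP => a b; rewrite !companionE; congr (_ + _ * ('X * _%:P)).
rewrite -!addnA.
apply: eq_weight => k /andP [_ lt_k].
by apply: eZ; lia.
Qed.

(** The perturbed matrix is a Schur complement of a bordered matrix in which the parameter t occurs
    in one column only. Its determinant is therefore affine in t, and is interpolated here between t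
    = 0 and t = 1. *)
Lemma size_det_rank1 r (A : 'M[{poly R}]_r) (y : 'cV_r) (z : 'rV_r) :
  \det (A + 'X *: (y *m z)) = (1 - 'X) * \det A + 'X * \det (A + y *m z).
Proof.
pose D (t : {poly R}) := \det (block_mx (1%:M : 'M_1) z (- t *: y) A).
have detD t : D t = \det (A + t *: (y *m z)).
  rewrite /D; have -> : block_mx (1%:M : 'M_1) z (- t *: y) A =
            block_mx 1%:M 0 (- t *: y) 1%:M *m block_mx 1%:M z 0 (A + t *: (y *m z)).
    rewrite mulmx_block !mul1mx !mul0mx !mulmx1 ?mulmx0 !addr0.
    by congr block_mx; rewrite -scalemxAl scaleNr addrCA addNr addr0.
  by rewrite det_mulmx det_lblock det_ublock !det1 !mul1r.
rewrite -[in RHS](scale1r (y *m z)) -!detD.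
have -> : \det A = D 0 by rewrite detD scale0r addr0.
rewrite /D -!(det_tr (block_mx _ _ _ _)) !tr_block_mx.
pose B t : 'M_(1 + r) := block_mx (1%:M : 'M_1)^T (- t *: y)^T z^T A^T.
rewrite -/(B 'X) -/(B 0) -/(B 1).
apply: (@determinant_multilinear _ _ _ _ _ (lshift r 0)).
- apply/rowP => j; rewrite !mxE.
  have -> : fintype.split (lshift r (0 : 'I_1)) = inl 0 by apply: (unsplitK (inl 0)).
  case: (split_ordP j) => k ->.
    by rewrite !row_mxEl !mxE; ring.
  by rewrite !row_mxEr !mxE; ring.
- apply/matrixP => i j; rewrite !mxE; case: fintype.splitP => // k ek.
  by have := ltn_ord k; rewrite -ek.
- apply/matrixP => i j; rewrite !mxE; case: fintype.splitP => // k ek.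
  by have := ltn_ord k; rewrite -ek.
Qed.

End Transfer.

Section SizeBounds.
Variable R : comNzRingType.

Lemma size_mulmx m n k (A : 'M[{poly R}]_(m, n)) (B : 'M[{poly R}]_(n, k)) e f :
  (forall i j, (size (A i j) <= e)%N) -> (forall i j, (size (B i j) <= f)%N) ->
  forall i j, (size ((A *m B) i j) <= (e + f).-1)%N.
Proof.
move=> hA hB i j; rewrite mxE; apply: leq_trans (size_sum _ _ _) _.
apply/bigmax_leqP => l _; apply: leq_trans (size_polyMleq _ _) _.
by rewrite -!subn1 leq_sub2r ?leq_add.
Qed.

Lemma size_det n (A : 'M[{poly R}]_n) e :
  (forall i j, (size (A i j) <= e)%N) -> (size (\det A) <= (n * e).+1)%N.
Proof.
move=> hA; apply: leq_trans (size_sum _ _ _) _.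
apply/bigmax_leqP => g _; rewrite size_Msign.
apply: leq_trans (size_prod_leq _ _) _; apply: leq_trans (leq_subr _ _) _.
rewrite ltnS (@leq_trans (\sum_(i < n) e)) ?leq_sum //.
by rewrite sum_nat_const card_ord.
Qed.

Variables (K : Type) (iota : K -> R) (s : ncpoly K) (d : nat).

(* Each companion factor depends on X through a rank one term, so every minor of the
   transfer matrix has degree at most the number of factors. *)
Lemma size_det_transfer Z p l r (V : 'M[{poly R}]_(r, d)) (U : 'M[{poly R}]_(d, r)) e :
  (forall i j, (size (V i j) <= e)%N) -> (forall i j, (size (U i j) <= e)%N) ->
  (size (\det (V *m transfer iota s d Z p l *m U)) <= l + (r * (e + e)).+1)%N.
Proof.
move=> hV; elim: l U => [|l IHl] U hU.
  rewrite /= mulmx1 add0n; apply: size_det => i j.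
  by apply: leq_trans (size_mulmx hV hU i j) _; apply: leq_pred.
have hS i j : (size (shift_mx R d i j) <= 1)%N.
  by rewrite mxE; case: eqP; rewrite ?size_poly0 ?size_poly1.
have hC i j : (size ((shift_mx R d + weight_col iota s d Z (p + l)%N *m last_row R d)%R i j) <= 1)%N.
  rewrite !mxE big_ord1 !mxE; apply: leq_trans (size_polyD _ _) _.
  rewrite geq_max; apply/andP; split; first by case: eqP; rewrite ?size_poly0 ?size_poly1.
  by case: eqP; rewrite ?mulr1 ?mulr0 ?size_poly0 // size_polyC leq_b1.
(* Splitting the last companion factor displays the rank one term. Both determinants given by
   [size_det_rank1] absorb a factor with constant entries into [U], which keeps the bound [e], so
   each position costs a single degree. *)
have eC : V *m transfer iota s d Z p l.+1 *m U =
    V *m transfer iota s d Z p l *m (shift_mx R d *m U) +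
    'X *: ((V *m transfer iota s d Z p l *m weight_col iota s d Z (p + l)%N) *m (last_row R d *m U)).
  by rewrite /= /companion !mulmxDr !mulmxDl -!scalemxAr -!scalemxAl !mulmxA.
rewrite eC size_det_rank1; apply: leq_trans (size_polyD _ _) _.
rewrite geq_max addSn; apply/andP; split.
  apply: leq_trans (size_polyMleq _ _) _; rewrite -opprB size_polyN size_XsubC /= ltnS.
  by apply: IHl => i j; have := size_mulmx hS hU i j; rewrite add1n.
apply: leq_trans (size_polyMleq _ _) _; rewrite size_polyX /= ltnS.
have -> : V *m transfer iota s d Z p l *m (shift_mx R d *m U) +
    V *m transfer iota s d Z p l *m weight_col iota s d Z (p + l)%N *m (last_row R d *m U) =
    V *m transfer iota s d Z p l *m
      ((shift_mx R d + weight_col iota s d Z (p + l)%N *m last_row R d) *m U).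
  by rewrite mulmxDl mulmxDr !mulmxA.
by apply: IHl => i j; have := size_mulmx hC hU i j; rewrite add1n.
Qed.

End SizeBounds.

Section MapTransfer.
Variables (K : Type) (R R' : comNzRingType) (iota : K -> R) (phi : {rmorphism R -> R'}).

Lemma map_word_weight (Z : nat -> 'rV[R]_3) i w :
  phi (word_weight Z i w) = word_weight (fun k => map_mx phi (Z k)) i w.
Proof. by elim: w i => [|c w IHw] i /=; rewrite ?rmorph1 // rmorphM IHw mxE. Qed.

Lemma map_transfer s d (Z : nat -> 'rV[R]_3) p l :
  map_mx (map_poly phi) (transfer iota s d Z p l) =
  transfer (phi \o iota) s d (fun k => map_mx phi (Z k)) p l.
Proof.
elim: l => [|l IHl] /=; first by rewrite map_mx1.
rewrite map_mxM IHl; congr (_ *m _); apply/matrixP => a b.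
rewrite !companionE mxE companionE rmorphD !rmorphM !rmorph_nat /= map_polyX map_polyC /=.
congr (_ + _ * ('X * _%:P)); rewrite /weight raddf_sum; apply: eq_bigr => u _.
by rewrite -map_word_weight -rmorphM.
Qed.

End MapTransfer.

(** * Multidegrees of transfer matrices *)

Section PairHomogeneous.
Variables (K : closedFieldType) (q : nat) (i : 'I_q).
Local Notation S := {mpoly K[q + q]}.

(* Degrees are integers so that [a, b) can be given degree [k < b] - [k < a]
   without assuming a <= b. *)
Definition pair_hom (z : int) (p : S) := {in msupp p, forall m, (pair_deg m i)%:Z = z}.

Lemma pair_hom0 z : pair_hom z 0.
Proof. by move=> m; rewrite msupp0. Qed.

Lemma pair_homC c : pair_hom 0 c%:MP.
Proof.
move=> m; rewrite msuppC; case: ifP => // _; rewrite inE => /eqP ->.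
by rewrite /pair_deg !mnm0E.
Qed.

Lemma pair_homD z p1 p2 : pair_hom z p1 -> pair_hom z p2 -> pair_hom z (p1 + p2).
Proof. by move=> h1 h2 m /msuppD_le; rewrite mem_cat => /orP [/h1|/h2]. Qed.

Lemma pair_homM z1 z2 p1 p2 :
  pair_hom z1 p1 -> pair_hom z2 p2 -> pair_hom (z1 + z2) (p1 * p2).
Proof.
move=> h1 h2 m /msuppM_le /allpairsP [[m1 m2] /= [/h1 <- /h2 <- ->]].
by rewrite pair_degD PoszD.
Qed.

Lemma pair_hom_sum z (I : Type) (r : seq I) (Q : pred I) F :
  (forall j, Q j -> pair_hom z (F j)) -> pair_hom z (\sum_(j <- r | Q j) F j).
Proof. by move=> h; apply: big_ind => //; [apply: pair_hom0 | apply: pair_homD]. Qed.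

Definition poly_hom z (p : {poly S}) := forall k, pair_hom z p`_k.

Lemma poly_homC z c : pair_hom z c -> poly_hom z c%:P.
Proof. by move=> h k; rewrite coefC; case: ifP => // _; apply: pair_hom0. Qed.

Lemma poly_hom0 z : poly_hom z 0.
Proof. by move=> k; rewrite coef0; apply: pair_hom0. Qed.

Lemma poly_hom1 : poly_hom 0 1.
Proof. by apply: poly_homC; rewrite -mpolyC1; apply: pair_homC. Qed.

Lemma poly_homD z p1 p2 : poly_hom z p1 -> poly_hom z p2 -> poly_hom z (p1 + p2).
Proof. by move=> h1 h2 k; rewrite coefD; apply: pair_homD. Qed.

Lemma poly_homM z1 z2 p1 p2 :
  poly_hom z1 p1 -> poly_hom z2 p2 -> poly_hom (z1 + z2) (p1 * p2).
Proof.
by move=> h1 h2 k; rewrite coefM; apply: pair_hom_sum => j _; apply: pair_homM.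
Qed.

Lemma poly_homX z p : poly_hom z p -> poly_hom z ('X * p).
Proof. by move=> h k; rewrite coefXM; case: ifP => // _; apply: pair_hom0. Qed.

Lemma poly_hom_sum z (I : Type) (r : seq I) (Q : pred I) F :
  (forall j, Q j -> poly_hom z (F j)) -> poly_hom z (\sum_(j <- r | Q j) F j).
Proof. by move=> h; apply: big_ind => //; [apply: poly_hom0 | apply: poly_homD]. Qed.

Lemma poly_hom_prod z n F : (forall j : 'I_n, poly_hom z (F j)) ->
  poly_hom (z * n%:Z) (\prod_j F j).
Proof.
elim: n F => [|n IHn] F hF; first by rewrite big_ord0 mulr0; apply: poly_hom1.
rewrite big_ord_recl intS mulrDr mulr1; apply: poly_homM => //.
by apply: IHn => j; apply: hF.
Qed.

Lemma poly_hom_sign n : poly_hom 0 ((-1) ^+ n).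
Proof.
elim: n => [|n IHn]; first by rewrite expr0; apply: poly_hom1.
have hN1 : poly_hom 0 (-1).
  by rewrite -polyCN -mpolyC1 -mpolyCN; apply/poly_homC/pair_homC.
by have := poly_homM hN1 IHn; rewrite addr0 exprS.
Qed.

Lemma poly_hom_det z n (A : 'M_n) : (forall a b, poly_hom z (A a b)) ->
  poly_hom (z * n%:Z) (\det A).
Proof.
move=> hA; apply: poly_hom_sum => g _; rewrite -[z * _]add0r; apply: poly_homM.
  exact: poly_hom_sign.
by apply: poly_hom_prod => j; apply: hA.
Qed.

Lemma poly_hom_mulmx m n k (A : 'M_(m, n)) (B : 'M_(n, k)) z1 z2 :
  (forall a b, poly_hom z1 (A a b)) -> (forall a b, poly_hom z2 (B a b)) ->
  forall a b, poly_hom (z1 + z2) ((A *m B) a b).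
Proof.
by move=> hA hB a b; rewrite mxE; apply: poly_hom_sum => c _; apply: poly_homM.
Qed.

Variables (s : ncpoly K) (d : nat) (Z : nat -> 'rV[S]_3) (k0 : nat).
Hypothesis Z_hom : forall k c, pair_hom (k == k0)%:Z (Z k 0 c).
Local Notation iota := (@mpolyC (q + q) K).

Let past (k : nat) : int := (k0 < k)%N%:Z.

Lemma pair_hom_word_weight a w :
  pair_hom (past (a + size w) - past a) (word_weight Z a w).
Proof.
elim: w a => [|c w IHw] a /=; first by rewrite addn0 subrr -mpolyC1; apply: pair_homC.
have -> : past (a + (size w).+1) - past a =
    (a == k0)%:Z + (past (a.+1 + size w) - past a.+1).
  by rewrite addSnnS /past; case: ltngtP => //; lia.
by apply: pair_homM.
Qed.

Lemma pair_hom_weight a b : pair_hom (past b - past a) (weight iota s Z a b).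
Proof.
apply: pair_hom_sum => u /eqP <-; rewrite -[_ - _]add0r; apply: pair_homM.
  exact: pair_homC.
exact: pair_hom_word_weight.
Qed.

(** Row [a] stands for the position [p + a], column [b] for [p + l + b]. A shift entry joins equal
    positions and has degree 0, the last column of a factor carries weights between its two
    positions, and degrees telescope along products. *)
Lemma poly_hom_transfer p l (a b : 'I_d) :
  poly_hom (past (p + l + b) - past (p + a)) (transfer iota s d Z p l a b).
Proof.
elim: l a b => [|l IHl] a b /=.
  rewrite mxE addn0; case: eqP => [->|_]; last exact: poly_hom0.
  by rewrite subrr; apply: poly_hom1.
rewrite mxE; apply: poly_hom_sum => c _.
have -> : past (p + l.+1 + b) - past (p + a) =
    (past (p + l + c) - past (p + a)) + (past (p + l + b.+1) - past (p + l + c)).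
  by rewrite addnS addSn -addnS; ring.
apply: poly_homM => //; rewrite companionE; apply: poly_homD.
  case: eqP => [->|_]; last exact: poly_hom0.
  by rewrite subrr; apply: poly_hom1.
case: eqP => [ebd|_]; last by rewrite mul0r; apply: poly_hom0.
have -> : (p + l + b.+1 = p + l + d)%N by rewrite ebd.
by rewrite mul1r; apply/poly_homX/poly_homC/pair_hom_weight.
Qed.

End PairHomogeneous.

(** Every [pos i] lies beyond all row positions and before all column positions, so each entry of
    the transfer matrix has degree 1 in each pair, while [V] and [U] have degree 0. *)
Lemma multihomog_det_transfer (K : closedFieldType) q (s : ncpoly K) d
    (Z : nat -> 'rV[{mpoly K[q + q]}]_3) (pos : 'I_q -> nat) p l r
    (V : 'M[{poly K}]_(r, d)) (U : 'M[{poly K}]_(d, r)) k :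
  (forall i j c, pair_hom i (j == pos i)%:Z (Z j 0 c)) ->
  (forall i, (p + d <= pos i < p + l)%N) ->
  multihomog r (\det (map_mx (map_poly (@mpolyC (q + q) K)) V *m
    transfer (@mpolyC (q + q) K) s d Z p l *m map_mx (map_poly (@mpolyC (q + q) K)) U))`_k.
Proof.
move=> Z_hom pos_p m mp; apply/forallP => i.
have hC m1 m2 (A : 'M[{poly K}]_(m1, m2)) a b :
    poly_hom i 0 (map_mx (map_poly (@mpolyC (q + q) K)) A a b).
  by move=> j; rewrite mxE coef_map; apply: pair_homC.
have h1 a b : poly_hom i 1 (transfer (@mpolyC (q + q) K) s d Z p l a b).
  have := @poly_hom_transfer K q i s d Z (pos i) (Z_hom i) p l a b.
  have /andP [lo hi] := pos_p i; have lta := ltn_ord a.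
  have -> : (pos i < p + l + b)%N by lia.
  by have -> : (pos i < p + a)%N = false by lia.
have := poly_hom_det (poly_hom_mulmx (poly_hom_mulmx (hC _ _ V) h1) (hC _ _ U)) mp.
by rewrite add0r addr0 mul1r => -[->].
Qed.

(** * Killing windows *)

(** Rank at most [r] over the fraction field, witnessed by a factorization with cleared
    denominators. *)
Definition rank_le (R : idomainType) d (P : 'M[R]_d) r : Prop :=
  exists c (U : 'M_(d, r)) (V : 'M_(r, d)), c != 0 /\ c *: P = U *m V.

Lemma rank_le_full (R : idomainType) d (P : 'M[R]_d) : rank_le P d.
Proof. by exists 1, 1%:M, P; rewrite oner_neq0 scale1r mul1mx. Qed.

Lemma rank_le0 (R : idomainType) d (P : 'M[R]_d) : rank_le P 0 -> P = 0.
Proof.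
move=> [c [U [V [c0 /matrixP eP]]]]; apply/matrixP => i j; apply/eqP.
by have /eqP := eP i j; rewrite [V]flatmx0 mulmx0 !mxE mulf_eq0 (negPf c0).
Qed.

(** If [v] is in the left kernel and [v 0 k] is non-zero, then [v 0 k] times row [k] is a
    combination of the other rows, which make up [V]. *)
Lemma singular_factor (R : idomainType) r (M : 'M[R]_r.+1) : \det M = 0 ->
  exists c (U : 'M_(r.+1, r)) (V : 'M_(r, r.+1)), c != 0 /\ c *: M = U *m V.
Proof.
move/eqP/det0P => [v /rV0Pn [k vk] vM].
exists (v 0 k), (\matrix_(i, j) if i == k then - v 0 (lift k j)
  else (i == lift k j)%:R * v 0 k), (row' k M); split=> //.
apply/matrixP => i b; rewrite !mxE; have [->|ik] := eqVneq i k.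
  have /rowP /(_ b) := vM; rewrite !mxE (bigD1_ord k) //= => /eqP.
  rewrite addr_eq0 => /eqP ->; rewrite -sumrN; apply: eq_bigr => j _.
  by rewrite !mxE eqxx mulNr.
have [j ->] : exists j, i = lift k j.
  by case: (unliftP k i) => [j ->|ek]; [exists j | rewrite ek eqxx in ik].
have ne j' : (lift k j' == k) = false by rewrite eq_sym (negPf (neq_lift _ _)).
rewrite (bigD1 j) //= !mxE ne eqxx mul1r big1 ?addr0 // => j' /negPf jj'.
by rewrite !mxE ne (inj_eq lift_inj) eq_sym jj' !mul0r.
Qed.

Lemma rank_le_drop (R : idomainType) d r (P1 P2 P3 : 'M[R]_d) c1 c3
    (U1 U3 : 'M_(d, r.+1)) (V1 V3 : 'M_(r.+1, d)) :
  c1 != 0 -> c1 *: P1 = U1 *m V1 -> c3 != 0 -> c3 *: P3 = U3 *m V3 ->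
  \det (V1 *m P2 *m U3) = 0 -> rank_le (P1 *m P2 *m P3) r.
Proof.
move=> c1n0 e1 c3n0 e3 /singular_factor [c [U [V [cn0 e]]]].
exists (c1 * c * c3), (U1 *m U), (V *m V3); split; first by rewrite !mulf_neq0.
have -> : (c1 * c * c3) *: (P1 *m P2 *m P3) = c *: ((c1 *: P1) *m P2 *m (c3 *: P3)).
  rewrite -!scalemxAl -!scalemxAr !scalerA; congr (_ *: _); ring.
rewrite e1 e3 -[in RHS]mulmxA [U *m _]mulmxA -e -!scalemxAl -!scalemxAr.
by rewrite !mulmxA.
Qed.

Section Patterns.
Variable K : closedFieldType.

(* Each free position contributes two projective lines: with fewer than half of the
   positions prescribed, there are more lines than positions. *)
Record pattern (w : nat -> option 'rV[K]_3) (L : nat) : Prop := Pattern {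
  pattern_periodic : forall i, w (i + L)%N = w i;
  pattern_neq0 : forall i z, w i = Some z -> z != 0;
  pattern_sparse : (2 * count (fun i => isSome (w i)) (iota 0 L) < L)%N
}.

Definition compatible (w : nat -> option 'rV[K]_3) (zeta : nat -> 'rV[K]_3) :=
  forall i z, w i = Some z -> zeta i = z.

Lemma periodic_mul (T : Type) (f : nat -> T) L : (forall i, f (i + L)%N = f i) ->
  forall k i, f (k * L + i)%N = f i.
Proof.
by move=> fL; elim=> // k IHk i; rewrite mulSn -addnA addnC fL IHk.
Qed.

Lemma count_periodic (a : pred nat) L : (forall i, a (i + L)%N = a i) ->
  forall k n, count a (iota (k * L) (n * L)) = (n * count a (iota 0 L))%N.
Proof.
move=> aL k; elim=> [|n IHn]; first by rewrite mul0n.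
rewrite mulSn addnC iotaD count_cat IHn mulSn addnC; congr (_ + _)%N.
rewrite -mulnDl -[X in iota X L]addn0 iotaDl count_map.
by apply: eq_count => i /=; apply: periodic_mul.
Qed.

(** The coefficients of the product (x + y T)(x' + y' T). *)
Definition pair_product (R : comNzRingType) (x y x' y' : R) : 'rV[R]_3 :=
  \row_c [:: x * x'; x * y' + y * x'; y * y']`_c.

Lemma pair_product_neq0 (x y x' y' : K) : (x != 0) || (y != 0) -> (x' != 0) || (y' != 0) ->
  pair_product x y x' y' != 0.
Proof.
move=> xy xy'; apply/eqP => /rowP h.
have := h 0; have := h 1; have := h (inord 2); rewrite !mxE /= inordK //= => e2 e1 e0.
have [x0|x0] := eqVneq x 0.
  have y0 : y != 0 by move: xy; rewrite x0 eqxx.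
  move: e2 e1 => /eqP; rewrite mulf_eq0 (negPf y0) /= => /eqP y'0 /eqP.
  rewrite y'0 mulr0 add0r mulf_eq0 (negPf y0) /= => x'0.
  by move: xy'; rewrite x'0 y'0 eqxx.
move: e0 e1 => /eqP; rewrite mulf_eq0 (negPf x0) /= => /eqP x'0 /eqP.
rewrite x'0 mulr0 addr0 mulf_eq0 (negPf x0) /= => y'0.
by move: xy'; rewrite x'0 y'0 eqxx.
Qed.

Lemma map_pair_product (R R' : comNzRingType) (phi : {rmorphism R -> R'}) x y x' y' :
  map_mx phi (pair_product x y x' y') = pair_product (phi x) (phi y) (phi x') (phi y').
Proof.
apply/rowP => c; rewrite !mxE; case: c => [[|[|[|c]]] hc] //=;
  by rewrite ?rmorphD ?rmorphM.
Qed.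

End Patterns.

Section Kill.
Variables (K : closedFieldType) (s : ncpoly K) (d : nat).
Local Notation transferK := (transfer (@idfun K) s d).

Section Middle.
Variables (base : nat -> 'rV[K]_3) (free : seq nat).
Hypotheses (base_neq0 : forall i, base i != 0) (free_uniq : uniq free).
Let f := size free.
Let q := (f + f)%N.
Local Notation S := {mpoly K[q + q]}.
Local Notation X i := ('X_(lshift q i) : S).
Local Notation Y i := ('X_(rshift q i) : S).

(** [index] returns [size free] outside of [free], so [insub] succeeds exactly at the free
    positions. Each of them owns the two pairs [lshift f o] and [rshift f o]. *)
Definition symbolic_path m : 'rV[S]_3 :=
  if insub (index m free) is Some o
  then pair_product (X (lshift f o)) (Y (lshift f o)) (X (rshift f o)) (Y (rshift f o))
  else map_mx (@mpolyC (q + q) K) (base m).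

Definition position (i : 'I_q) : nat :=
  nth 0%N free (match fintype.split i with inl o => val o | inr o => val o end).

Lemma positionL (o : 'I_f) : position (lshift f o) = nth 0%N free o.
Proof.
rewrite /position; case: fintype.splitP => j /= ej; first by rewrite ej.
by have := ltn_ord o; rewrite ej ltnNge leq_addr.
Qed.

Lemma positionR (o : 'I_f) : position (rshift f o) = nth 0%N free o.
Proof.
rewrite /position; case: fintype.splitP => j /= ej.
  by have := ltn_ord j; rewrite -ej ltnNge leq_addr.
by congr nth; apply/eqP; rewrite -(eqn_add2l f) ej.
Qed.

Lemma position_free i : position i \in free.
Proof.
by rewrite /position mem_nth //; case: fintype.splitP => j _; apply: ltn_ord.
Qed.

Lemma pair_hom_var (i j : 'I_q) :
  pair_hom i (i == j)%:Z (X j) /\ pair_hom i (i == j)%:Z (Y j).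
Proof.
split=> m; rewrite msuppX inE => /eqP ->; rewrite /pair_deg !mnm1E.
  by rewrite eq_lrshift (inj_eq (@lshift_inj _ _)) eq_sym; case: eqP.
by rewrite eq_rlshift (inj_eq (@rshift_inj _ _)) eq_sym; case: eqP.
Qed.

Lemma symbolic_path_hom i m c : pair_hom i (m == position i)%:Z (symbolic_path m 0 c).
Proof.
rewrite /symbolic_path; case: insubP => [o _ eo|nlt]; last first.
  rewrite mxE; have -> : (m == position i) = false; last exact: pair_homC.
  by apply/eqP => em; move: nlt; rewrite index_mem em position_free.
have hp j : pair_hom i (i == j)%:Z (X j) := (pair_hom_var i j).1.
have hp' j : pair_hom i (i == j)%:Z (Y j) := (pair_hom_var i j).2.
have -> : (m == position i)%:Z = (i == lshift f o)%:Z + (i == rshift f o)%:Z.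
  have mf : m \in free by rewrite -index_mem -eo; apply: ltn_ord.
  have em : m = nth 0%N free o by rewrite eo nth_index.
  have eqo (o' : 'I_f) : (m == nth 0%N free o') = (o' == o).
    by rewrite em nth_uniq ?ltn_ord // eq_sym.
  case: (split_ordP i) => o' ->.
    by rewrite positionL eqo eq_lrshift (inj_eq (@lshift_inj _ _)) eq_sym; case: eqP.
  by rewrite positionR eqo eq_rlshift (inj_eq (@rshift_inj _ _)) eq_sym; case: eqP.
rewrite mxE; case: c => [[|[|[|c]]] hc] //=; try apply: pair_homD; try exact: pair_homM.
Qed.

(* The coefficients of the determinant are forms of multidegree (r, .., r) in the
   pairs of variables, and there are fewer of them than pairs. *)
Lemma singular_middle p l r e (V : 'M[{poly K}]_(r, d)) (U : 'M[{poly K}]_(d, r)) :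
  (0 < r)%N -> (forall i j, (size (V i j) <= e)%N) -> (forall i j, (size (U i j) <= e)%N) ->
  (forall m, m \in free -> (p + d <= m < p + l)%N) ->
  (l + (r * (e + e)).+1 < f + f)%N ->
  exists zeta, [/\ forall m, zeta m != 0, forall m, m \notin free -> zeta m = base m &
    \det (V *m transferK zeta p l *m U) = 0].
Proof.
move=> r_gt0 hV hU hfree lt_q.
pose C m n (A : 'M[{poly K}]_(m, n)) := map_mx (map_poly (@mpolyC (q + q) K)) A.
pose D := \det (C _ _ V *m transfer (@mpolyC (q + q) K) s d symbolic_path p l *m C _ _ U).
have sC m n (A : 'M[{poly K}]_(m, n)) i j : (size (C _ _ A i j) <= size (A i j))%N.
  by rewrite mxE size_poly.
have sD : (size D <= l + (r * (e + e)).+1)%N.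
  apply: size_det_transfer.
    by move=> i j; apply: leq_trans (hV i j).
  by move=> i j; apply: leq_trans (hU i j).
have [|v [vD v_neq0]] := @multihomog_common_zero K q _ r
    (fun k : 'I_(l + (r * (e + e)).+1) => D`_k) _ r_gt0 lt_q.
  move=> k; apply: (@multihomog_det_transfer K q s d symbolic_path position) => //.
    exact: symbolic_path_hom.
  move=> i; apply: hfree; exact: position_free.
have baseE m : map_mx (meval v) (map_mx (@mpolyC (q + q) K) (base m)) = base m.
  by apply/rowP => c; rewrite !mxE mevalC.
exists (fun m => map_mx (meval v) (symbolic_path m)); split.
- move=> m; rewrite /symbolic_path; case: insubP => [o _ eo|_].
    by rewrite map_pair_product; apply: pair_product_neq0; rewrite /= !mevalXU.
  by rewrite baseE.
- move=> m nm; rewrite /symbolic_path insubN; last by rewrite index_mem.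
  by rewrite baseE.
have : map_poly (meval v) D = 0.
  apply/polyP => k; rewrite coef_map coef0.
  have [lt_k|le_k] := ltnP k (l + (r * (e + e)).+1); first exact: (vD (Ordinal lt_k)).
  have -> : D`_k = 0 by apply/nth_default/(leq_trans sD le_k).
  exact: meval0.
have CK m n (A : 'M[{poly K}]_(m, n)) : map_mx (map_poly (meval v)) (C _ _ A) = A.
  apply/matrixP => i j; rewrite !mxE -map_poly_comp map_poly_id // => x _.
  by rewrite /= mevalC.
rewrite -det_map_mx !map_mxM !CK map_transfer.
by have -> : meval v \o @mpolyC (q + q) K = idfun by apply/funext => x; rewrite /= mevalC.
Qed.

End Middle.
Variables (w : nat -> option 'rV[K]_3) (L : nat).
Hypothesis wP : pattern w L.

Definition default_path (m : nat) : 'rV[K]_3 := odflt (const_mx 1) (w m).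

Lemma default_path_neq0 m : default_path m != 0.
Proof.
rewrite /default_path; case e: (w m) => [z|] /=; first exact: (pattern_neq0 wP e).
by apply/eqP => /rowP /(_ 0) /eqP; rewrite !mxE oner_eq0.
Qed.

Lemma default_path_compatible : compatible w default_path.
Proof. by move=> m z e; rewrite /default_path e. Qed.

(** Two copies of the path, a whole number of periods apart and so both compatible with [w], are
    separated by [k'] periods in which every unprescribed position is free. [singular_middle] fills
    these, and [rank_le_drop] applies to the three successive transfer matrices. *)
Lemma low_rank_path j : exists k l zeta,
  [/\ (l + d <= k * L)%N, forall m, zeta m != 0, compatible w zeta
    & rank_le (transferK zeta 0 l) (d - j)].
Proof.
have L_gt0 : (0 < L)%N by apply: leq_trans (pattern_sparse wP).
elim: j => [|j [k [l [zeta [le_l zeta_neq0 zeta_w rk]]]]].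
  exists d, 0%N, default_path; split.
  - by rewrite add0n leq_pmulr.
  - exact: default_path_neq0.
  - exact: default_path_compatible.
  - by rewrite subn0; apply: rank_le_full.
have [le_dj|lt_jd] := leqP d j.
  exists k, l, zeta; split=> //; move: rk.
  by have -> : (d - j.+1 = d - j)%N by lia.
have edj : (d - j = (d - j.+1).+1)%N by lia.
rewrite edj in rk; set r := (d - j.+1)%N in rk *.
have [c [U [V [c_neq0 eUV]]]] := rk.
pose e := maxn (\max_i \max_i' size (V i i')) (\max_i \max_i' size (U i i')).
have hV i i' : (size (V i i') <= e)%N.
  apply: leq_trans (leq_maxl _ _); apply: leq_trans (leq_bigmax i).
  exact: (@leq_bigmax _ (fun i' => size (V i i'))).
have hU i i' : (size (U i i') <= e)%N.
  apply: leq_trans (leq_maxr _ _); apply: leq_trans (leq_bigmax i).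
  exact: (@leq_bigmax _ (fun i' => size (U i i'))).
(* Since fewer than half of the positions are prescribed, twice the number of free positions is at
   least [k' * L.+1]. The excess [k'] over [k' * L] is chosen to outweigh the part of [len] outside
   these periods and the constant [B]. *)
pose B := (r.+1 * (e + e)).+1; pose k' := (k * L + B + 1)%N.
pose free := [seq m <- iota (k * L) (k' * L) | ~~ isSome (w m)].
pose base m := if (m < k * L)%N then zeta m else
  if (m < k * L + k' * L)%N then default_path m else zeta (m - (k * L + k' * L))%N.
pose len := (k * L + k' * L - l)%N.
have szf : size free = (k' * (L - count (fun i => isSome (w i)) (iota 0 L)))%N.
  rewrite size_filter (@count_periodic (fun m => ~~ isSome (w m))); last first.
    by move=> m; rewrite (pattern_periodic wP).
  congr (_ * _)%N; have := count_predC (fun i => isSome (w i)) (iota 0 L).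
  by rewrite size_iota => {2}<-; rewrite addKn.
have [||||zeta' [zeta'_neq0 zeta'_base det0]] :=
    @singular_middle base free _ _ l len r.+1 e V U isT hV hU.
- by move=> m; rewrite /base; do 2 case: ifP => _ //; apply: default_path_neq0.
- by rewrite filter_uniq // iota_uniq.
- by move=> m; rewrite mem_filter mem_iota /len => /andP [_ /andP [h1 h2]]; lia.
- rewrite szf -/B /len; have := pattern_sparse wP.
  set n := count _ _ => sparse.
  have : (k' * L.+1 <= k' * (L - n) + k' * (L - n))%N.
    by rewrite -mulnDr leq_mul2l; apply/orP; right; lia.
  by rewrite mulnS {1}/k'; lia.
have free_ge m : m \in free -> (k * L <= m < k * L + k' * L)%N.
  by rewrite mem_filter mem_iota => /andP [].
exists (k + k' + k)%N, (k * L + k' * L + l)%N, zeta'; split=> //.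
- by rewrite !mulnDl; lia.
- move=> m z e_m; rewrite zeta'_base; last by rewrite mem_filter e_m.
  rewrite /base; case: ltnP => h1; first exact: zeta_w.
  case: ltnP => h2; first exact: default_path_compatible.
  apply: zeta_w; rewrite -e_m -[in RHS](subnKC h2) -mulnDl.
  by rewrite (periodic_mul (pattern_periodic wP)).
have -> : (k * L + k' * L + l = l + (len + l))%N by rewrite /len; lia.
rewrite transferD transferD mulmxA !add0n.
have -> : (l + len = k * L + k' * L)%N by rewrite /len; lia.
have -> : transferK zeta' 0 l = transferK zeta 0 l.
  apply: eq_transfer => i lt_i; rewrite !add0n zeta'_base ?/base.
    by have -> : (i < k * L)%N by lia.
  by apply/negP => /free_ge; lia.
have -> : transferK zeta' (k * L + k' * L) l = transferK zeta 0 l.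
  apply: eq_transfer => i lt_i; rewrite add0n zeta'_base /base.
    by rewrite ltnNge leqNgt !ifN; [rewrite addKn|lia|lia].
  by apply/negP => /free_ge; lia.
exact: (rank_le_drop c_neq0 eUV c_neq0 eUV det0).
Qed.

Lemma killing_path : exists k l zeta,
  [/\ (l + d <= k * L)%N, forall m, zeta m != 0, compatible w zeta
    & transferK zeta 0 l = 0].
Proof.
have [k [l [zeta [h1 h2 h3 rk]]]] := low_rank_path d.
by rewrite subnn in rk; exists k, l, zeta; split=> //; apply: rank_le0.
Qed.

End Kill.

Definition recurrently_killed (K : fieldType) (zeta : nat -> 'rV[K]_3)
    (s : ncpoly K) (d : nat) : Prop :=
  exists L l, (0 < L)%N /\ forall j, transfer (@idfun K) s d zeta (j * L) l = 0.

Lemma extend_pattern (K : closedFieldType) (s : ncpoly K) d (w : nat -> option 'rV[K]_3) L :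
  pattern w L -> exists w' L', [/\ pattern w' L', forall i z, w i = Some z -> w' i = Some z
    & forall zeta, compatible w' zeta -> recurrently_killed zeta s d].
Proof.
move=> wP; have [k [l [zeta [le_l zeta_neq0 zeta_w kill]]]] := killing_path s d wP.
have L_gt0 : (0 < L)%N by apply: leq_trans (pattern_sparse wP).
(* If [k] is 0 then so is [d], and all transfer matrices are empty. *)
have [k0|k_gt0] := posnP k.
  exists w, L; split=> // zeta' _; exists 1%N, 0%N; split=> // j /=.
  have d0 : d = 0%N by move: le_l; rewrite k0; lia.
  by subst d; rewrite [LHS]flatmx0.
(* The window fills the first [n] positions of a new period [M], a multiple of [L]. Prescribed
   positions number at most [n + L.+1 * k * c] with [2 * c < L], and the factor [L.+2] is what keeps
   this below half of [M]. *)
pose n := (k * L)%N; pose M := (L.+2 * n)%N.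
have n_gt0 : (0 < n)%N by rewrite muln_gt0 k_gt0.
have M_gt0 : (0 < M)%N by rewrite muln_gt0.
pose w' i := if (i %% M < n)%N then Some (zeta (i %% M)%N) else w i.
have w_modM i : w (i %% M)%N = w i.
  rewrite [in RHS](divn_eq i M) /M /n !mulnA.
  by rewrite (periodic_mul (pattern_periodic wP)).
exists w', M; split.
- split.
  + move=> i; rewrite /w' modnDr -[w (i + M)%N]w_modM -[w i]w_modM.
    by rewrite modnDr.
  + move=> i z; rewrite /w'; case: ifP => _; first by case=> <-.
    exact: (pattern_neq0 wP).
  + have -> : M = (n + L.+1 * n)%N by rewrite /M mulSn.
    rewrite iotaD count_cat add0n.
    have h1 : (count (fun i => isSome (w' i)) (iota 0 n) <= n)%N.
      by rewrite -[X in (_ <= X)%N](size_iota 0 n) count_size.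
    have h2 : count (fun i => isSome (w' i)) (iota n (L.+1 * n)) =
        count (fun i => isSome (w i)) (iota n (L.+1 * n)).
      apply: eq_in_count => i; rewrite mem_iota => /andP [le_ni lt_i].
      have lt_iM : (i < M)%N by rewrite /M mulSn.
      by rewrite /w' modn_small // ltnNge le_ni.
    have h3 : count (fun i => isSome (w i)) (iota n (L.+1 * n)) =
        (L.+1 * k * count (fun i => isSome (w i)) (iota 0 L))%N.
      rewrite /n mulnA (@count_periodic (fun m => isSome (w m))) //.
      by move=> m; rewrite (pattern_periodic wP).
    rewrite h2 h3; move: (pattern_sparse wP) h1; set c := count _ _; set c' := count _ _.
    move=> sparse h1.
    have : (L.+1 * k * (2 * c).+1 <= L.+1 * k * L)%N by rewrite leq_mul2l sparse orbT.
    rewrite /n mulnS; move: h1; rewrite /n; nia.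
- move=> i z e; rewrite /w'; case: ifP => // _; congr Some; apply: zeta_w.
  by rewrite w_modM.
- move=> zeta' zeta'_w; exists M, l; split=> // j; rewrite -kill.
  apply: eq_transfer => i lt_i; apply: zeta'_w.
  have lt_in : (i < n)%N by apply: leq_trans le_l.
  have lt_iM : (i < M)%N by rewrite (leq_trans lt_in) // /M mulSn leq_addr.
  by rewrite /w' modnMDl modn_small // lt_in add0n.
Qed.

(** Countability of [K] makes the pairs [(s, d)] enumerable by [pickle]. Stage [n] handles the pair
    of code [n], and no stage undoes earlier prescriptions, so [zeta] can follow their union and be
    a constant non-zero vector elsewhere. *)
Theorem recurrently_killed_path (K : countClosedFieldType) :
  exists zeta : nat -> 'rV[K]_3,
    (forall m, zeta m != 0) /\ forall s d, recurrently_killed zeta s d.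
Proof.
pose state := {w : (nat -> option 'rV[K]_3) * nat | pattern w.1 w.2}.
have [|next nextP] := @choice (nat * state) state (fun a b =>
    (forall i z, (sval a.2).1 i = Some z -> (sval b).1 i = Some z) /\
    forall zeta sd, unpickle a.1 = Some (sd : ncpoly K * nat) ->
      compatible (sval b).1 zeta -> recurrently_killed zeta sd.1 sd.2).
  move=> [n [[w L] wP]] /=; case: (unpickle n) => [[s d]|]; last by exists (exist _ (w, L) wP).
  have [w' [L' [wP' ww' kill]]] := extend_pattern s d wP.
  by exists (exist _ (w', L') wP'); split=> // zeta sd [<-]; apply: kill.
have w0P : @pattern K (fun=> None) 1 by [].
pose st := fix st n := if n is n'.+1 then next (n', st n') else exist _ (fun=> None, 1%N) w0P.
pose w n := (sval (st n)).1.
have w_mono m n i z : (m <= n)%N -> w m i = Some z -> w n i = Some z.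
  move=> /subnK <-; elim: (n - m)%N => //= k IHk e; rewrite addSn.
  by apply: (nextP (_, _)).1 => /=; apply: IHk.
have [|zeta zetaP] := @choice nat 'rV[K]_3 (fun i z => z != 0 /\
    forall n z', w n i = Some z' -> z = z').
  move=> i; have [[n [z e]]|no] := pselect (exists n z, w n i = Some z).
    exists z; split=> [|n' z' e']; first exact: (pattern_neq0 (svalP (st n)) e).
    have := w_mono _ _ i _ (leq_maxl n n') e; rewrite (w_mono _ _ i _ (leq_maxr n n') e').
    by case.
  exists (const_mx 1); split=> [|n z e]; last by case: no; exists n, z.
  by apply/eqP => /rowP /(_ 0) /eqP; rewrite !mxE oner_eq0.
exists zeta; split=> [m|s d]; first by case: (zetaP m).
apply: ((nextP (pickle (s, d), st (pickle (s, d)))).2 zeta (s, d)); first by rewrite pickleK.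
by move=> i z e; apply: (zetaP i).2 (_ : w (pickle (s, d)).+1 i = Some z).
Qed.

(** * The algebra of weighted shifts *)

Section Convolution.
Variable K : fieldType.
Local Notation F := (nat -> nat -> K^o).
Implicit Types a b c : F.

Definition strictly_upper a := forall i m, (m <= i)%N -> a i m = 0.

(** The product of infinite matrices: for strictly upper triangular [b] the terms with k >= m
    vanish, which leaves a finite sum. *)
Definition conv a b : F := fun i m => \sum_(k < m) a i k * b k m.

Lemma conv_assoc a b c : strictly_upper b -> conv (conv a b) c = conv a (conv b c).
Proof.
move=> ub; apply/funext => i; apply/funext => m; rewrite /conv.
transitivity (\sum_(k < m) \sum_(j < m) a i j * b j k * c k m).
  apply: eq_bigr => k _; rewrite mulr_suml.
  rewrite (big_ord_widen m (fun j => a i j * b j k * c k m)) 1?ltnW //.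
  rewrite big_mkcond; apply: eq_bigr => j _; case: ltnP => // le_kj.
  by rewrite ub // mulr0 mul0r.
rewrite exchange_big; apply: eq_bigr => j _; rewrite mulr_sumr.
by apply: eq_bigr => k _; rewrite mulrA.
Qed.

Lemma convDl a b c : conv (a + b) c = conv a c + conv b c.
Proof.
apply/funext => i; apply/funext => m; rewrite /conv -[RHS]big_split.
by apply: eq_bigr => k _; rewrite mulrDl.
Qed.

Lemma convDr a b c : conv a (b + c) = conv a b + conv a c.
Proof.
apply/funext => i; apply/funext => m; rewrite /conv -[RHS]big_split.
by apply: eq_bigr => k _; rewrite mulrDr.
Qed.

Lemma convZl (x : K) a b : conv (x *: a) b = x *: conv a b.
Proof.
apply/funext => i; apply/funext => m; rewrite /conv [RHS]mulr_sumr.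
by apply: eq_bigr => k _; rewrite mulrA.
Qed.

Lemma convZr (x : K) a b : conv a (x *: b) = x *: conv a b.
Proof.
apply/funext => i; apply/funext => m; rewrite /conv [RHS]mulr_sumr.
by apply: eq_bigr => k _; rewrite mulrCA.
Qed.

Variable a : F.
Hypothesis ua : strictly_upper a.
Local Notation pw n := (iter n (conv a) a).

Lemma conv_power_eq0 n i m : (m <= i + n)%N -> pw n i m = 0.
Proof.
elim: n i => [|n IHn] i le_m /=; first by apply: ua; rewrite addn0 in le_m.
rewrite /conv big1 // => k _; have [le_ki|lt_ik] := leqP k i; first by rewrite ua // mul0r.
by rewrite IHn ?mulr0 //; lia.
Qed.

Lemma conv_powerSr n : pw n.+1 = conv (pw n) a.
Proof.
elim: n => // n IHn; rewrite [LHS]iterS [in LHS]IHn -conv_assoc // => i m le_mi.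
by rewrite conv_power_eq0 // (leq_trans le_mi) // leq_addr.
Qed.

End Convolution.

(** * Nilpotency from recurring zero windows *)

Section Nilpotent.
Variables (K : fieldType) (zeta : nat -> 'rV[K]_3) (s : ncpoly K).
Hypothesis s_pos : all (fun u => (0 < size u.2)%N) s.
Let a : nat -> nat -> K^o := weight (@idfun K) s zeta.
Local Notation pw n := (iter n (conv a) a).

Lemma weight_strictly_upper : strictly_upper a.
Proof.
move=> i m le_mi; rewrite /a /weight big1_seq // => u /andP [/eqP e us].
by have := allP s_pos u us; lia.
Qed.

Variable d : nat.
Hypothesis s_le : all (fun u => (size u.2 <= d)%N) s.

Lemma weight_far i m : (i + d < m)%N -> a i m = 0.
Proof.
move=> lt_m; rewrite /a /weight big1_seq // => u /andP [/eqP e us].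
by have := allP s_le u us; lia.
Qed.

(** The series (1 - X a)^-1 up to degree [N], as [pw n] is the power n+1 of [a]. In columns [m <= N]
    the truncation is invisible, because the power N+1 of [a] vanishes there; so [GE] is the
    identity G = 1 + G X a. *)
Let G N (i m : nat) : {poly K} := (i == m)%:R + \sum_(n < N) (pw n i m)%:P * 'X^(n.+1).

Let GE N i m : (m <= N)%N ->
  G N i m = (i == m)%:R + \sum_(k < m) G N i k * ('X * (a k m)%:P).
Proof.
move=> le_mN; congr (_ + _).
transitivity (\sum_(n < N.+1) (pw n i m)%:P * 'X^(n.+1)).
  rewrite big_ord_recr /= conv_power_eq0 ?mul0r ?addr0 //; first exact: weight_strictly_upper.
  by rewrite (leq_trans le_mN) // leq_addl.
rewrite big_ord_recl /= mul_polyC expr1.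
transitivity ((a i m)%:P * 'X + \sum_(n < N) \sum_(k < m) (pw n i k * a k m)%:P * 'X^(n.+2)).
  congr (_ + _); first by rewrite mul_polyC.
  apply: eq_bigr => n _; rewrite -[conv a _]/(pw n.+1) conv_powerSr; last exact: weight_strictly_upper.
  by rewrite /conv rmorph_sum mulr_suml.
rewrite exchange_big /G /=.
under [RHS]eq_bigr do rewrite mulrDl.
rewrite big_split /=; congr (_ + _).
  have [lt_im|le_mi] := ltnP i m.
    rewrite (bigD1 (Ordinal lt_im)) //= eqxx mul1r mulrC big1 ?addr0 // => k /negPf ne.
    by rewrite eq_sym [_ == _]ne mul0r.
  rewrite weight_strictly_upper // mul0r big1 // => k _.
  by rewrite gtn_eqF ?mul0r // (leq_trans (ltn_ord k)).
apply: eq_bigr => k _; rewrite mulr_suml; apply: eq_bigr => n _.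
by rewrite polyCM exprS; ring.
Qed.

Let v N i p : 'rV[{poly K}]_d := \row_b G N i (p + b)%N.

(** The only new entry is the one in column [p + d]. There the identity matrix contributes nothing
    as [i < p + d], and columns before [p] are too far to contribute. *)
Let v_step N i p : (i < p + d)%N -> (p + d <= N)%N ->
  v N i p.+1 = v N i p *m companion (@idfun K) s d zeta p.
Proof.
move=> lt_i le_N; apply/rowP => b; rewrite !mxE.
under eq_bigr do rewrite mxE companionE mulrDr.
rewrite big_split /=; have [eb|neb] := eqVneq b.+1 d.
  rewrite big1 ?add0r => [|c _]; last by rewrite eb ltn_eqF ?mulr0.
  have -> : (p.+1 + b = p + d)%N by rewrite addSnnS eb.
  rewrite GE // (ltn_eqF lt_i) add0r big_split_ord /= big1 ?add0r => [|k _]; last first.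
    by rewrite weight_far ?polyC0 ?mulr0 // ltn_add2r.
  by apply: eq_bigr => k _; rewrite mul1r.
rewrite [X in _ + X]big1 ?addr0 => [|c _]; last by rewrite mul0r mulr0.
have lt_b : (b.+1 < d)%N by rewrite ltn_neqAle neb ltn_ord.
rewrite (bigD1 (Ordinal lt_b)) //= eqxx mulr1 addSnnS big1 ?addr0 // => c ne.
by case: eqP => [e|_]; rewrite ?mulr0 //; case/eqP: ne; apply: val_inj.
Qed.

Let v_transfer N i p l : (i < p + d)%N -> (p + l + d <= N.+1)%N ->
  v N i (p + l)%N = v N i p *m transfer (@idfun K) s d zeta p l.
Proof.
move=> lt_i; elim: l => [|l IHl] le_N; first by rewrite addn0 mulmx1.
rewrite addnS v_step /=; last 2 first.
- by rewrite (leq_trans lt_i) // leq_add2r leq_addr.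
- by rewrite addnS in le_N.
by rewrite IHl ?mulmxA //; lia.
Qed.

(** A zero transfer matrix annihilates row [i] of the series from the end of its window on. Such a
    window starts within distance [L] after [i], so the power L+l+1 of [a] vanishes in the columns
    beyond [i + L + l]; in the others it vanishes by strict triangularity. The exponent does not
    depend on [i]. *)
Lemma killed_nilpotent : (0 < d)%N -> recurrently_killed zeta s d ->
  exists n, iter n (conv a) a = 0.
Proof.
move=> d_gt0 [L [l [L_gt0 kill]]]; exists (L + l)%N.
apply/funext => i; apply/funext => m; rewrite -[RHS]/0.
have [le_m|lt_m] := leqP m (i + (L + l)).
  by apply: conv_power_eq0 => //; apply: weight_strictly_upper.
pose j := (i %/ L).+1; pose p := (j * L)%N.
have lt_ip : (i < p)%N by rewrite /p ltn_ceil.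
have le_p : (p <= i + L)%N by rewrite /p /j mulSn addnC leq_add2r leq_divM.
(* Large enough both for the recursion up to column [m + d] and for the coefficient of degree
   [L + l + 1] to be present. *)
pose N := (m + d + (L + l).+1)%N.
have vm : v N i (p + l + (m - (p + l)))%N = 0.
  rewrite v_transfer; [|lia|rewrite /N; lia].
  rewrite v_transfer; [|lia|rewrite /N; lia].
  by rewrite kill mulmx0 mul0mx.
have : G N i m = 0.
  have /rowP /(_ (Ordinal d_gt0)) := vm; rewrite !mxE /= addn0 subnKC //; lia.
have lt_N : (L + l < N)%N by rewrite /N; lia.
move/(congr1 (fun h : {poly K} => h`_(L + l).+1)).
rewrite coef0 coefD coef_sum (bigD1 (Ordinal lt_N)) //= coefCM coefXn eqxx mulr1.
rewrite big1 => [|n ne]; last first.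
  rewrite coefCM coefXn eqSS; case: eqP => [e|_]; last by rewrite mulr0.
  by case/eqP: ne; apply: val_inj.
by rewrite addr0 ltn_eqF ?coef0 ?add0r //; lia.
Qed.

End Nilpotent.

Section ShiftAlgebra.
Variables (K : fieldType) (zeta : nat -> 'rV[K]_3).
Local Notation F := (nat -> nat -> K^o).
Local Notation wt s := (weight (@idfun K) s zeta : F).

Definition nonempty_words (s : ncpoly K) := all (fun u => 0 < size u.2)%N s.

Definition shift_element (a : F) : Prop := exists s, nonempty_words s /\ a = wt s.

Lemma weight_cat s t : wt (s ++ t) = wt s + wt t.
Proof. by apply/funext => i; apply/funext => m; rewrite /weight big_cat. Qed.

Lemma weight_scale c s : wt [seq (c * u.1, u.2) | u <- s] = c *: wt s.
Proof.
apply/funext => i; apply/funext => m; rewrite /weight big_map [RHS]mulr_sumr.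
by apply: eq_bigr => u _; rewrite mulrA.
Qed.

Lemma weight_mul s t i m : nonempty_words t ->
  \sum_(k < m) weight (@idfun K) s zeta i k * weight (@idfun K) t zeta k m =
  weight (@idfun K) [seq (u.1 * v.1, u.2 ++ v.2) | u <- s, v <- t] zeta i m.
Proof.
move=> t_pos; rewrite /weight.
rewrite [RHS]big_mkcond big_allpairs_dep.
transitivity (\sum_(k < m) \sum_(u <- s) (if (i + size u.2)%N == k
    then u.1 * word_weight zeta i u.2 else 0) *
    \sum_(v <- t | (k + size v.2)%N == m) v.1 * word_weight zeta k v.2).
  by apply: eq_bigr => k _; rewrite [X in X * _]big_mkcond mulr_suml.
rewrite exchange_big; apply: eq_bigr => u _ /=.
have [lt_m|le_m] := ltnP (i + size u.2) m; last first.
  rewrite [LHS]big1 => [|k _]; last first.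
    by case: eqP => [e|_]; rewrite ?mul0r //; have := ltn_ord k; rewrite -e ltnNge le_m.
  rewrite big1_seq // => v /andP [_ vt]; rewrite size_cat addnA gtn_eqF //.
  by have := allP t_pos v vt; lia.
rewrite (bigD1 (Ordinal lt_m)) //= eqxx [X in _ + X]big1 ?addr0 => [|k ne]; last first.
  by case: eqP => [e|_]; rewrite ?mul0r //; case/eqP: ne; apply: val_inj.
rewrite [in LHS]big_mkcond mulr_sumr; apply: eq_bigr => v _; rewrite size_cat addnA.
case: eqP => // _; last by rewrite mulr0.
by rewrite word_weight_cat; ring.
Qed.

Lemma weight_conv s t : nonempty_words t ->
  conv (wt s) (wt t) = wt [seq (u.1 * v.1, u.2 ++ v.2) | u <- s, v <- t].
Proof.
by move=> t_pos; apply/funext => i; apply/funext => m; apply: weight_mul.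
Qed.

Lemma shift_element_upper a : shift_element a -> strictly_upper a.
Proof. by move=> [s [s_pos ->]]; apply: weight_strictly_upper. Qed.

Lemma shift_element_conv a b : shift_element a -> shift_element b -> shift_element (conv a b).
Proof.
move=> [s [s_pos ->]] [t [t_pos ->]]; rewrite weight_conv //.
eexists; split; last by [].
apply/allP => _ /allpairsP [[u v] [us _ ->]] /=; rewrite size_cat addn_gt0.
by have /= -> := allP s_pos u us.
Qed.

Definition shift_pred : {pred F} := [pred a | `[< shift_element a >]].

Lemma shift_pred_submod : submod_closed shift_pred.
Proof.
split; first by apply/asboolP; exists [::]; split=> //; apply/funext => i; apply/funext => m;
  rewrite /weight big_nil.
move=> c a b /asboolP [s [s_pos ->]] /asboolP [t [t_pos ->]]; apply/asboolP.
exists ([seq (c * u.1, u.2) | u <- s] ++ t); rewrite weight_cat weight_scale; split=> //.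
by rewrite /nonempty_words all_cat all_map; apply/andP; split.
Qed.

(** Elements are matrices, with the representing list forgotten, so that equality is pointwise and
    the module structure is inherited from functions. *)
Record shift_algebra := ShiftAlgebra {
  shift_val :> F;
  shift_valP : shift_val \in shift_pred
}.

HB.instance Definition _ := [isSub for shift_val].
HB.instance Definition _ := [Choice of shift_algebra by <:].
HB.instance Definition _ := GRing.SubChoice_isSubLmodule.Build K F shift_pred shift_algebra
  shift_pred_submod.

Lemma shift_mulP (a b : shift_algebra) : conv a b \in shift_pred.
Proof.
apply/asboolP; apply: shift_element_conv; apply/asboolP; exact: shift_valP.
Qed.

Definition shift_mul a b := ShiftAlgebra (shift_mulP a b).

Lemma shift_upper (a : shift_algebra) : strictly_upper a.
Proof. by apply: shift_element_upper; apply/asboolP; apply: shift_valP. Qed.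

Lemma shift_mulA : associative shift_mul.
Proof. by move=> a b c; apply: val_inj => /=; rewrite conv_assoc //; apply: shift_upper. Qed.

HB.instance Definition _ := hasMul.Build shift_algebra shift_mul.
HB.instance Definition _ := Magma_isSemigroup.Build shift_algebra shift_mulA.

Lemma shift_mulDl (a b c : shift_algebra) : ((a + b)%R * c)%g = (a * c)%g + (b * c)%g.
Proof. by apply: val_inj => /=; rewrite convDl. Qed.
Lemma shift_mulDr (a b c : shift_algebra) : (a * (b + c)%R)%g = (a * b)%g + (a * c)%g.
Proof. by apply: val_inj => /=; rewrite convDr. Qed.
HB.instance Definition _ :=
  Zmodule_Semigroup_isNonUnitalRing.Build shift_algebra shift_mulDl shift_mulDr.

Lemma shift_scaleAl (x : K) (a b : shift_algebra) : x *: (a * b)%g = ((x *: a) * b)%g.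
Proof. by apply: val_inj => /=; rewrite convZl. Qed.
Lemma shift_scaleAr (x : K) (a b : shift_algebra) : x *: (a * b)%g = (a * (x *: b))%g.
Proof. by apply: val_inj => /=; rewrite convZr. Qed.
HB.instance Definition _ := Lmodule_NonUnitalRing_isNonUnitalAlgebra.Build K shift_algebra
  shift_scaleAl shift_scaleAr.

End ShiftAlgebra.

Section ShiftAlgebraProperties.
Variables (K : fieldType) (zeta : nat -> 'rV[K]_3).
Local Notation A := (shift_algebra zeta).
Implicit Types a b : A.

Lemma shift_eqP a b : (forall i m, a i m = b i m) -> a = b.
Proof. by move=> e; apply: val_inj; apply/funext => i; apply/funext => m; apply: e. Qed.

Lemma shift_sumE (I : Type) (r : seq I) (P : pred I) (f : I -> A) i m :
  (\sum_(j <- r | P j) f j) i m = \sum_(j <- r | P j) f j i m.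
Proof. by apply: (big_morph (fun a : A => a i m)). Qed.

Lemma shift_mulE a b i m : (a * b)%g i m = \sum_(k < m) a i k * b k m.
Proof. by []. Qed.

Lemma shift_repr a : exists s, nonempty_words s /\ shift_val a = weight (@idfun K) s zeta.
Proof. exact: (asboolP _ (shift_valP a)). Qed.

Lemma weight_in_shift s : nonempty_words s -> weight (@idfun K) s zeta \in shift_pred zeta.
Proof. by move=> s_pos; apply/asboolP; exists s. Qed.

Definition shift_of s (s_pos : nonempty_words s) : A := ShiftAlgebra (weight_in_shift s_pos).

Lemma shift_bounded a : exists d, (0 < d)%N /\ forall i m, (i + d < m)%N -> a i m = 0.
Proof.
have [s [s_pos ea]] := shift_repr a; exists (\max_(u <- s) size u.2).+1; split=> // i m lt_m.
rewrite ea; apply: weight_far lt_m => //.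
apply/allP => u us; rewrite ltnW // ltnS.
  exact: (@leq_bigmax_seq _ s predT (fun u => size u.2) u us isT).
Qed.

Definition shift_part j : {pred A} := [pred a : A | `[< forall i m, m <> (i + j)%N -> a i m = 0 >]].

Lemma shift_partP j a : reflect (forall i m, m <> (i + j)%N -> a i m = 0) (a \in shift_part j).
Proof. exact: asboolP. Qed.

Lemma shift_part_submod j : submod_closed (shift_part j).
Proof.
split=> [|c a b /shift_partP ha /shift_partP hb]; first by apply/shift_partP.
apply/shift_partP => i m ne.
have -> : (c *: a + b) i m = c * a i m + b i m by [].
by rewrite ha // hb // mulr0 addr0.
Qed.

(** Keeping the words of length [j] extracts the [j]-th diagonal, so homogeneous components stay in
    the algebra. *)
Lemma shift_component a j : (0 < j)%N ->
  exists b, forall i m, b i m = if m == (i + j)%N then a i m else 0.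
Proof.
move=> j_gt0; have [s [s_pos ea]] := shift_repr a.
have t_pos : nonempty_words [seq u <- s | size u.2 == j].
  by apply/allP => u; rewrite mem_filter => /andP [/eqP -> _].
exists (shift_of t_pos) => i m; rewrite ea /= /weight big_filter_cond.
case: eqP => [->|ne].
  by apply: eq_bigl => u; rewrite eqn_add2l andbb.
by rewrite big1 // => u /andP [/eqP -> /eqP e]; case: ne.
Qed.

Lemma shift_direct_sum : direct_sum_from 1 shift_part.
Proof.
split=> [i _|a|n f hf f0 j /andP [j_gt0 lt_jn]]; first exact: shift_part_submod.
- have [d [d_gt0 a_d]] := shift_bounded a.
  have /choice [f hf] : forall j, exists b : A, (0 < j)%N ->
      forall i m, b i m = if m == (i + j)%N then a i m else 0.
    move=> j; case: (posnP j) => [_|/(shift_component a) [b hb]]; first by exists 0.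
    by exists b.
  exists d.+1, f; split=> [j /andP [j_gt0 _]|].
    by apply/shift_partP => i m /eqP ne; rewrite hf // (negPf ne).
  apply: shift_eqP => i m; rewrite shift_sumE.
  have [le_mi|lt_im] := leqP m i.
    rewrite shift_upper // big_nat_cond big1 // => j /andP [/andP [j_gt0 _] _].
    by rewrite hf //; case: eqP => // e; lia.
  have [lt_m|le_m] := ltnP (i + d) m.
    rewrite a_d // big_nat_cond big1 // => j /andP [/andP [j_gt0 j_d] _].
    by rewrite hf //; case: eqP => // e; lia.
  rewrite (bigD1_seq (m - i)%N) /= ?iota_uniq //; last by rewrite mem_index_iota; lia.
  rewrite hf ?subn_gt0 // subnKC 1?ltnW // eqxx big_nat_cond big1 ?addr0 //.
  move=> j /andP [/andP [j_gt0 _] /eqP ne]; rewrite hf //; case: eqP => // e.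
  by case: ne; lia.
apply: shift_eqP => i m; have [->|ne] := eqVneq m (i + j)%N; last first.
  have /shift_partP hfj : f j \in shift_part j by apply: hf; rewrite j_gt0.
  by rewrite hfj //; apply/eqP.
have := congr1 (fun b : A => b i (i + j)%N) f0; rewrite shift_sumE.
rewrite (bigD1_seq j) /= ?iota_uniq //; last by rewrite mem_index_iota j_gt0.
rewrite big_nat_cond big1 ?addr0 // => k /andP [k_n /eqP ne].
have /shift_partP hfk := hf k k_n; apply: hfk => /eqP.
by rewrite eqn_add2l => /eqP e; case: ne.
Qed.

Lemma shift_grading : positive_grading shift_part.
Proof.
split; first exact: shift_direct_sum.
move=> i j _ _ a b /shift_partP ha /shift_partP hb; apply/shift_partP => p m ne.
rewrite shift_mulE big1 // => k _; have [ek|nek] := eqVneq (k : nat) (p + i)%N.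
  by rewrite hb ?mulr0 // => em; apply: ne; rewrite em ek addnA.
by rewrite ha ?mul0r //; apply/eqP.
Qed.

Definition shift_word (w : seq 'I_3) (w_pos : (0 < size w)%N) : A :=
  @shift_of [:: (1, w)] (introT andP (conj w_pos isT)).

Lemma shift_wordE w w_pos i m :
  @shift_word w w_pos i m = if (i + size w == m)%N then word_weight zeta i w else 0.
Proof. by rewrite /= /weight big_cons big_nil /= mul1r addr0. Qed.

Lemma shift_word_cons c w wc_pos w_pos :
  @shift_word (c :: w) wc_pos = (@shift_word [:: c] isT * @shift_word w w_pos)%g.
Proof.
apply: shift_eqP => i m; rewrite shift_mulE.
under eq_bigr => k _ do rewrite !shift_wordE.
rewrite shift_wordE /= addn1 addnS -addSn mulr1.
have [lt_m|le_m] := ltnP i.+1 m; last first.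
  rewrite big1 => [|k _]; first by rewrite ifN //; lia.
  by case: eqP => [e|_]; rewrite ?mul0r //; have := ltn_ord k; lia.
rewrite (bigD1 (Ordinal lt_m)) //= eqxx.
rewrite big1 ?addr0; first by case: ifP; rewrite ?mulr0.
move=> k ne; case: eqP => [e|_]; rewrite ?mul0r //.
by case/eqP: ne; apply: val_inj.
Qed.

Lemma shift_generated : generated_by [seq @shift_word [:: c] isT | c : 'I_3].
Proof.
move=> S [[S0 Slin] Smul] Sgen x.
have Sword w w_pos : @shift_word w w_pos \in S.
  elim: w w_pos => // c [|c' w] IHw w_pos.
    have -> : shift_word w_pos = @shift_word [:: c] isT by apply: shift_eqP.
    by apply: Sgen; apply: map_f; rewrite mem_enum.
  rewrite (@shift_word_cons c (c' :: w) w_pos isT); apply: Smul; last exact: IHw.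
  by apply: Sgen; apply: map_f; rewrite mem_enum.
have Ss s s_pos : @shift_of s s_pos \in S.
  elim: s s_pos => [|[c w] s IHs] s_pos.
    suff -> : shift_of s_pos = 0 by [].
    by apply: shift_eqP => i m; rewrite /= /weight big_nil.
  have /andP [/= w_pos s'_pos] := s_pos.
  suff -> : shift_of s_pos = c *: shift_word w_pos + shift_of s'_pos by apply: Slin.
  apply: shift_eqP => i m.
  have -> : (c *: shift_word w_pos + shift_of s'_pos) i m =
    c * shift_word w_pos i m + shift_of s'_pos i m by [].
  rewrite shift_wordE /= /weight big_cons /=; case: ifP => //.
  by rewrite mulr0 add0r.
have [s [s_pos ex]] := shift_repr x.
suff -> : x = shift_of s_pos by [].
by apply: val_inj; exact: ex.
Qed.

Lemma shift_fin_gen : fin_gen_degree_one shift_part.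
Proof.
exists [seq @shift_word [:: c] isT | c : 'I_3]; split; last exact: shift_generated.
move=> _ /mapP [c _ ->]; apply/shift_partP => i m ne; rewrite shift_wordE /=.
by case: eqP => // e; case: ne.
Qed.

Lemma shift_nil : (forall s d, recurrently_killed zeta s d) -> nil_on (predT : {pred A}).
Proof.
move=> kill x _; have [s [s_pos ex]] := shift_repr x.
pose d := (\max_(u <- s) size u.2).+1.
have s_le : all (fun u => size u.2 <= d)%N s.
  apply/allP => u us; rewrite ltnW // ltnS.
  exact: (@leq_bigmax_seq _ s predT (fun u => size u.2) u us isT).
have [n xn] := killed_nilpotent s_pos s_le isT (kill s d).
exists n; apply: val_inj; rewrite -[RHS]xn -ex.
by elim: n {xn} => //= n ->.
Qed.
End ShiftAlgebraProperties.

(** * The point module *)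

Section PointModule.
Variables (K : fieldType) (zeta : nat -> 'rV[K]_3).
Hypothesis zeta_neq0 : forall i, zeta i != 0.
Local Notation A := (shift_algebra zeta).
Implicit Types (a b : A) (m : {poly K}).

Definition band a : nat := sval (cid (shift_bounded a)).

(** The monomial 'X^i stands for e_i and a polynomial for a finitely supported row vector,
    multiplied here by the matrix [a]. The band width bounds the support of the result. *)
Definition point_act m a : {poly K} :=
  \poly_(k < size m + band a) \sum_(i < k) m`_i * a i k.

Lemma coef_point_act m a k : (point_act m a)`_k = \sum_(i < k) m`_i * a i k.
Proof.
rewrite coef_poly; case: ltnP => // le_k; rewrite big1 // => i _.
have [lt_i|le_i] := ltnP i (size m); last by rewrite nth_default ?mul0r.
rewrite /band in le_k; case: (cid _) le_k => d [_ a_d] /= le_k.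
by rewrite a_d ?mulr0 // (leq_trans _ le_k) // ltn_add2r.
Qed.

Lemma point_right_action_proof : right_action point_act.
Proof.
split.
- move=> a c m m'; apply/polyP => k; rewrite coefD coefZ !coef_point_act mulr_sumr -big_split.
  by apply: eq_bigr => i _; rewrite coefD coefZ mulrDl mulrA.
- move=> m c a b; apply/polyP => k; rewrite coefD coefZ !coef_point_act mulr_sumr -big_split.
  apply: eq_bigr => i _.
  have -> : (c *: a + b) i k = c * a i k + b i k by [].
  by rewrite /= mulrDr mulrCA.
- move=> m a b; apply/polyP => k; rewrite !coef_point_act.
  under [RHS]eq_bigr do rewrite coef_point_act mulr_suml.
  under [LHS]eq_bigr do rewrite shift_mulE mulr_sumr.
  rewrite exchange_big; apply: eq_bigr => j _ /=.
  rewrite [RHS](big_ord_widen k (fun i => m`_i * a i j * b j k)) 1?ltnW //.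
  rewrite [RHS]big_mkcond; apply: eq_bigr => i _; case: ltnP => le_ji; first by rewrite mulrA.
  by rewrite (shift_upper a) // mul0r mulr0.
Qed.

Definition point_part j : {pred {poly K}} :=
  [pred m : {poly K} | `[< forall k, k <> j -> m`_k = 0 >]].

Lemma point_partP j m : reflect (forall k, k <> j -> m`_k = 0) (m \in point_part j).
Proof. exact: asboolP. Qed.

Lemma point_part_submod j : submod_closed (point_part j).
Proof.
split=> [|c m m' /point_partP hm /point_partP hm']; apply/point_partP => k ne.
  by rewrite coef0.
by rewrite coefD coefZ hm // hm' // mulr0 addr0.
Qed.

Lemma point_direct_sum_proof : direct_sum_from 0 point_part.
Proof.
split=> [i _|m|n f hf f0 j lt_jn]; first exact: point_part_submod.
- exists (size m), (fun i => m`_i *: 'X^i); split=> [j _|].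
    by apply/point_partP => k /eqP ne; rewrite coefZ coefXn (negPf ne) mulr0.
  by rewrite -[LHS]coefK poly_def big_mkord.
apply/polyP => k; rewrite coef0; have [->|/eqP ne] := eqVneq k j; last first.
  by have /point_partP := hf j lt_jn; apply.
have := congr1 (fun p : {poly K} => p`_j) f0; rewrite coef_sum coef0.
rewrite (bigD1_seq j) /= ?iota_uniq ?mem_index_iota // big_nat_cond big1 ?addr0 //.
move=> i /andP [i_n /eqP ne]; have /point_partP := hf i i_n; apply.
by move=> e; apply: ne.
Qed.

Lemma nonzero_word n i : exists w, size w = n /\ word_weight zeta i w != 0.
Proof.
elim: n i => [|n IHn] i; first by exists [::]; rewrite /= oner_neq0.
have [w [sw hw]] := IHn i.+1; have /rV0Pn [c hc] := zeta_neq0 i.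
by exists (c :: w); rewrite /= sw mulf_neq0.
Qed.

(** Some word of each length sends e_0 to a non-zero multiple of the corresponding e_k, so a
    suitable combination has any prescribed finite first row. This gives generation in degree
    zero. *)
Lemma first_row_surj m n : exists a, forall k, (0 < k)%N ->
  a 0%N k = if (k <= n)%N then m`_k else 0.
Proof.
elim: n => [|n [a ha]]; first by exists 0 => k k_gt0; rewrite leqNgt k_gt0.
have [w [sw hw]] := nonzero_word n.+1 0.
have w_pos : (0 < size w)%N by rewrite sw.
exists ((m`_n.+1 / word_weight zeta 0 w) *: shift_word zeta w_pos + a) => k k_gt0.
have -> : ((m`_n.+1 / word_weight zeta 0 w) *: shift_word zeta w_pos + a) 0%N k =
  m`_n.+1 / word_weight zeta 0 w * shift_word zeta w_pos 0%N k + a 0%N k by [].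
rewrite shift_wordE ha // sw add0n; case: (ltngtP k n.+1) => [lt_k|gt_k|->].
- by rewrite mulr0 add0r -ltnS lt_k.
- by rewrite mulr0 add0r ifN // -ltnNge (ltn_trans _ gt_k).
- by rewrite divfK // ltnn addr0.
Qed.

Lemma shift_point_module : point_module (@shift_part K zeta) point_act point_part.
Proof.
split.
- exact: point_right_action_proof.
- exact: point_direct_sum_proof.
- move=> i j _ m a /point_partP hm /shift_partP ha; apply/point_partP => k ne.
  rewrite coef_point_act big1 // => l _; have [el|nel] := eqVneq (l : nat) i.
    by rewrite ha ?mulr0 // el.
  by rewrite hm ?mul0r //; apply/eqP.
- move=> i; exists 'X^i; split=> [||m /point_partP hm].
  + by apply/point_partP => k /eqP ne; rewrite coefXn (negPf ne).
  + by rewrite monic_neq0 ?monicXn.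
  + exists m`_i; apply/polyP => k; rewrite coefZ coefXn.
    by have [->|/eqP ne] := eqVneq k i; rewrite ?mulr1 // mulr0 hm.
- move=> m; have [a ha] := first_row_surj m (size m).
  exists (m`_0)%:P, [:: (1, a)]; split.
  + by apply/point_partP => k /eqP ne; rewrite coefC (negPf ne).
  + move=> u; rewrite inE => /eqP -> /=.
    by apply/point_partP => k /eqP ne; rewrite coef1 (negPf ne).
  + rewrite big_seq1; apply/polyP => k; rewrite coefD coefC coef_point_act.
    case: k => [|k]; first by rewrite big_ord0 addr0.
    rewrite big_ord_recl /= coef1 mul1r add0r ha // big1 ?addr0 => [|i _].
      by case: ltnP => // le_k; rewrite nth_default // ltnW.
    by rewrite coef1 mul0r.
Qed.

End PointModule.

Lemma countClosedField_nil_algebra (K : countClosedFieldType) :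
  exists zeta : nat -> 'rV[K]_3,
    (forall i, zeta i != 0) /\ nil_on (predT : {pred shift_algebra zeta}).
Proof.
have [zeta [zeta_neq0 kill]] := recurrently_killed_path K.
by exists zeta; split=> //; apply: shift_nil.
Qed.

(** * Matrices over a nil ring *)

Section NonUnitalMatrices.
Variables (R : nuRingType) (n : nat).

(** An alias, to which the product built from the semigroup product of [R] is attached. *)
Definition nu_matrix : Type := 'M[R]_n.

HB.instance Definition _ := GRing.Zmodule.copy nu_matrix 'M[R]_n.

Lemma nu_mul0l (x : R) : (0%R * x)%g = 0.
Proof. by apply: (addrI (0%R * x)%g); rewrite -nu_mulDl !addr0. Qed.

Lemma nu_mul0r (x : R) : (x * 0%R)%g = 0.
Proof. by apply: (addrI (x * 0%R)%g); rewrite -nu_mulDr !addr0. Qed.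

Lemma nu_mul_suml (I : Type) (r : seq I) (P : pred I) (F : I -> R) x :
  ((\sum_(i <- r | P i) F i)%R * x)%g = \sum_(i <- r | P i) (F i * x)%g.
Proof. by apply: (big_morph (fun y => (y * x)%g)) => [y z|]; rewrite ?nu_mulDl ?nu_mul0l. Qed.

Lemma nu_mul_sumr (I : Type) (r : seq I) (P : pred I) (F : I -> R) x :
  (x * (\sum_(i <- r | P i) F i)%R)%g = \sum_(i <- r | P i) (x * F i)%g.
Proof. by apply: (big_morph (fun y => (x * y)%g)) => [y z|]; rewrite ?nu_mulDr ?nu_mul0r. Qed.

Definition nu_mulmx (X Y : nu_matrix) : nu_matrix :=
  \matrix_(i, j) \sum_k ((X : 'M[R]_n) i k * (Y : 'M[R]_n) k j)%g.

Lemma nu_mulmxA : associative nu_mulmx.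
Proof.
move=> X Y Z; apply/matrixP => i j; rewrite !mxE.
under eq_bigr do rewrite mxE nu_mul_sumr.
rewrite exchange_big; apply: eq_bigr => k _; rewrite mxE nu_mul_suml.
by apply: eq_bigr => l _; rewrite mulgA.
Qed.

HB.instance Definition _ := hasMul.Build nu_matrix nu_mulmx.
HB.instance Definition _ := Magma_isSemigroup.Build nu_matrix nu_mulmxA.

Lemma nu_mulmxDl (X Y Z : nu_matrix) : ((X + Y)%R * Z)%g = (X * Z)%g + (Y * Z)%g.
Proof.
apply/matrixP => i j; rewrite !mxE -big_split; apply: eq_bigr => k _.
by rewrite mxE nu_mulDl.
Qed.

Lemma nu_mulmxDr (X Y Z : nu_matrix) : (X * (Y + Z)%R)%g = (X * Y)%g + (X * Z)%g.
Proof.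
apply/matrixP => i j; rewrite !mxE -big_split; apply: eq_bigr => k _.
by rewrite mxE nu_mulDr.
Qed.

HB.instance Definition _ :=
  Zmodule_Semigroup_isNonUnitalRing.Build nu_matrix nu_mulmxDl nu_mulmxDr.

Lemma nu_mulmxE (X Y : nu_matrix) i j :
  ((X * Y)%g : 'M[R]_n) i j = \sum_k ((X : 'M[R]_n) i k * (Y : 'M[R]_n) k j)%g.
Proof. exact: mxE. Qed.

Definition column_ideal (k : 'I_n) : {pred nu_matrix} :=
  [pred X : nu_matrix | `[< forall i j, j != k -> (X : 'M[R]_n) i j = 0 >]].

Lemma column_idealP k (X : nu_matrix) :
  reflect (forall i j, j != k -> (X : 'M[R]_n) i j = 0) (X \in column_ideal k).
Proof. exact: asboolP. Qed.

Lemma column_left_ideal k : left_ideal (column_ideal k).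
Proof.
split; first split.
- by apply/column_idealP => i j _; rewrite mxE.
- move=> X Y /column_idealP hX /column_idealP hY; apply/column_idealP => i j ne.
  by rewrite !mxE hX // hY // subrr.
- move=> X Y /column_idealP hY; apply/column_idealP => i j ne.
  by rewrite nu_mulmxE big1 // => l _; rewrite hY // nu_mul0r.
Qed.

(** If [X] lives in column [k], left multiplication by [X] only sees row [k], so powers of [X] have
    powers of [x] at (k, k). One more factor [X] then clears the whole column. *)
Lemma column_nil k : nil_on (predT : {pred R}) -> nil_on (column_ideal k).
Proof.
move=> nilR X /column_idealP hX; pose x := (X : 'M[R]_n) k k.
have [m xm] := nilR x isT; exists m.+1.
have mulX (Y : nu_matrix) i j : ((X * Y)%g : 'M[R]_n) i j =
    ((X : 'M[R]_n) i k * (Y : 'M[R]_n) k j)%g.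
  rewrite nu_mulmxE (bigD1 k) //= big1 ?addr0 // => l ne.
  by rewrite hX // nu_mul0l.
have pw p : (iter p (fun Y => (X * Y)%g) X : 'M[R]_n) k k = iter p (fun y => (x * y)%g) x.
  by elim: p => //= p IHp; rewrite mulX IHp.
have pw0 p i j : j != k -> (iter p (fun Y => (X * Y)%g) X : 'M[R]_n) i j = 0.
  move=> ne; elim: p i => [|p IHp] i /=; first exact: hX.
  by rewrite mulX IHp nu_mul0r.
apply/matrixP => i j; rewrite [RHS]mxE iterS mulX.
have [->|ne] := eqVneq j k; first by rewrite pw xm nu_mul0r.
by rewrite pw0 // nu_mul0r.
Qed.

End NonUnitalMatrices.

Lemma ideal_sum_left_ideal (R : nuRingType) (I J : {pred R}) :
  left_ideal I -> left_ideal J -> left_ideal (ideal_sum I J).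
Proof.
move=> [[I0 IB] IM] [[J0 JB] JM]; split; first split.
- by apply/asboolP; exists 0, 0; rewrite addr0.
- move=> _ _ /asboolP [a [b [Ia Jb ->]]] /asboolP [c [d [Ic Jd ->]]]; apply/asboolP.
  exists (a - c), (b - d); split; [exact: IB | exact: JB | by rewrite opprD addrACA].
- move=> r _ /asboolP [a [b [Ia Jb ->]]]; apply/asboolP.
  by exists (r * a)%g, (r * b)%g; split; [exact: IM | exact: JM | rewrite nu_mulDr].
Qed.

(** [X] is the sum of its three columns. Either two column ideals already have a non-nil sum, or
    that sum is a nil left ideal and adding the third one yields [X]. *)
Lemma koethe_of_matrices (R : nuRingType) (X : nu_matrix R 3) :
  nil_on (predT : {pred R}) -> ~ nilpotent_elt X ->
  exists (S : nuRingType) (I J : {pred S}),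
    [/\ left_ideal I, left_ideal J, nil_on I, nil_on J & ~ nil_on (ideal_sum I J)].
Proof.
move=> nilR nX; pose C k := @column_ideal R 3 k.
have lC k : left_ideal (C k) := @column_left_ideal R 3 k.
have nC k : nil_on (C k) := @column_nil R 3 k nilR.
have [nil01|nnil] := pselect (nil_on (ideal_sum (C 0) (C 1))); last first.
  by exists (nu_matrix R 3), (C 0), (C 1).
exists (nu_matrix R 3), (ideal_sum (C 0) (C 1)), (C (inord 2)).
split=> //; first exact: ideal_sum_left_ideal.
move=> /(_ X); apply: contra_not nX; apply; apply/asboolP.
pose col k : nu_matrix R 3 := \matrix_(i, j) if j == k then (X : 'M[R]_3) i j else 0.
have colC k : col k \in C k.
  by apply/column_idealP => i j /negPf ne; rewrite mxE ne.
exists (col 0 + col 1), (col (inord 2)); split=> //.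
  by apply/asboolP; exists (col 0), (col 1).
apply/matrixP => i j; rewrite !mxE.
have [->|ne0] := eqVneq j 0; first by rewrite !ifN ?addr0 // -val_eqE /= inordK.
have [->|ne1] := eqVneq j 1; first by rewrite ifN ?add0r ?addr0 // -val_eqE /= inordK.
rewrite !add0r; case: eqP => // ne2; exfalso; apply: ne2; apply: val_inj.
rewrite /= inordK //; case: j ne0 ne1 => [[|[|[|j]]] hj] //.
Qed.

(** * A matrix over the algebra that is not nilpotent *)

Section NotNilpotent.
Variables (K : fieldType) (zeta : nat -> 'rV[K]_3).
Hypothesis zeta_neq0 : forall i, zeta i != 0.
Local Notation A := (shift_algebra zeta).
Local Notation x c := (@shift_word K zeta [:: c] isT).
Local Notation act := (@point_act K zeta).

Let actDr m a b : act m (a + b) = act m a + act m b.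
Proof.
by have := act_linear_r (point_right_action_proof zeta) m 1 a b; rewrite !scale1r.
Qed.

Let actDl a m m' : act (m + m') a = act m a + act m' a.
Proof.
by have := act_linear_l (point_right_action_proof zeta) a 1 m m'; rewrite !scale1r.
Qed.

Let act0r m : act m 0 = 0.
Proof. by apply: (addrI (act m 0)); rewrite -actDr !addr0. Qed.

Let actMr m a b : act m (a * b)%g = act (act m a) b.
Proof. exact: (actM (point_right_action_proof zeta)). Qed.

Let act_sumr m (I : Type) (r : seq I) (P : pred I) (f : I -> A) :
  act m (\sum_(i <- r | P i) f i) = \sum_(i <- r | P i) act m (f i).
Proof. by apply: (big_morph (act m)) => [y z|]; rewrite ?actDr ?act0r. Qed.

Let act0l a : act 0 a = 0.
Proof. by apply: (addrI (act 0 a)); rewrite -actDl !addr0. Qed.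

Let act_suml a (I : Type) (r : seq I) (P : pred I) (f : I -> {poly K}) :
  act (\sum_(i <- r | P i) f i) a = \sum_(i <- r | P i) act (f i) a.
Proof. by apply: (big_morph (act^~ a)) => [y z|]; rewrite ?actDl ?act0l. Qed.

(** With t = 'X and p(t) = x_0 t + x_1 t^2 + x_2 t^3, one has e_i p(t) = [weightpoly i] e_(i+1),
    hence e_0 p(t)^N = [pathpoly N] e_N. *)
Let weightpoly i : {poly K} := \sum_(c < 3) (zeta i 0 c)%:P * 'X^(c.+1).
Let pathpoly N : {poly K} := \prod_(i < N) weightpoly i.

(* u n = e_0 times the sum of the words of total weight n, where x c has weight c+1. *)
Let u n : {poly K} := \poly_(N < n.+1) (pathpoly N)`_n.

Let weightpolyE i : weightpoly i = 'X * \sum_(c < 3) (zeta i 0 c)%:P * 'X^c.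
Proof. by rewrite mulr_sumr; apply: eq_bigr => c _; rewrite exprS mulrCA. Qed.

Let weightpoly_neq0 i : weightpoly i != 0.
Proof.
have /rV0Pn [c hc] := zeta_neq0 i; apply/eqP => /polyP /(_ c.+1); rewrite coef0 coef_sum.
rewrite (bigD1 c) //= coefCM coefXn eqxx mulr1 big1 ?addr0; first by apply/eqP.
by move=> c' ne; rewrite coefCM coefXn eqSS eq_sym (negPf (ne : _ != _ :> nat)) mulr0.
Qed.

Let pathpoly_low N n : (n < N)%N -> (pathpoly N)`_n = 0.
Proof.
elim: N n => // N IHN n lt_n; rewrite /pathpoly big_ord_recr /= weightpolyE mulrCA coefXM.
case: n lt_n => // n lt_n; rewrite /= coefM big1 // => i _.
by rewrite IHN ?mul0r //; have := ltn_ord i; lia.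
Qed.

Let coef_u n N : (u n)`_N = (pathpoly N)`_n.
Proof. by rewrite coef_poly ltnS; case: leqP => // lt_n; rewrite pathpoly_low. Qed.

(** Sort the words of total weight n+3 by their last letter, of weight 1, 2 or 3. *)
Let u_rec n : u n.+3 = act (u n.+2) (x 0) + act (u n.+1) (x 1) + act (u n) (x (inord 2)).
Proof.
apply/polyP => N; rewrite !coefD !coef_point_act coef_u.
have xE c m (k : nat) : \sum_(i < m) (u k)`_i * x c i m =
    if m is m'.+1 then (u k)`_m' * zeta m' 0 c else 0.
  case: m => [|m]; first by rewrite big_ord0.
  under eq_bigr do rewrite shift_wordE addn1.
  rewrite big_ord_recr eqxx /= mulr1 big1 ?add0r // => i _.
  by rewrite eqSS ltn_eqF ?mulr0.
rewrite !xE; case: N => [|N]; first by rewrite /pathpoly big_ord0 coef1 !addr0.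
rewrite /pathpoly big_ord_recr /= -/(pathpoly N) /weightpoly mulr_sumr coef_sum.
rewrite !big_ord_recl big_ord0 addr0 !coef_u addrA.
have -> : lift ord0 (ord0 : 'I_2) = 1 :> 'I_3 by apply: val_inj.
have -> : lift ord0 (lift ord0 (ord0 : 'I_1)) = inord 2 :> 'I_3.
  by apply: val_inj; rewrite /= inordK.
have cE c k : (pathpoly N * ((zeta N 0 c)%:P * 'X^k))`_n.+3 =
    if (n.+3 < k)%N then 0 else (pathpoly N)`_(n.+3 - k) * zeta N 0 c.
  by rewrite mulrA coefMXn coefMC.
by rewrite !cE inordK //= ?subSS ?subn0.
Qed.

(* Columns of the cube of the companion matrix; the companion matrix itself has
   unit entries, hence is not a matrix over A. *)
Let Zcol (j : nat) (i : nat) : A :=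
  let x0 := x 0 in let x1 := x 1 in let x2 := x (inord 2) in
  let c1 i := nth 0 [:: x0; x1; x2] i in
  let c2 i := (c1 i * x0)%g + nth 0 [:: x1; x2] i in
  let c3 i := (c2 i * x0)%g + (c1 i * x1)%g + nth 0 [:: x2] i in
  nth 0 [:: c3 i; c2 i; c1 i] j.

Let Z : nu_matrix A 3 := \matrix_(i, j) Zcol j i.

Let rho n (j : nat) : {poly K} := u (n + (2 - j)).

Let apply_mx (r : 'I_3 -> {poly K}) (Y : nu_matrix A 3) j : {poly K} :=
  \sum_i act (r i) ((Y : 'M[A]_3) i j).

Let apply_mxM r Y Y' j : apply_mx (apply_mx r Y) Y' j = apply_mx r (Y * Y')%g j.
Proof.
rewrite /apply_mx; under eq_bigr do rewrite act_suml.
rewrite exchange_big; apply: eq_bigr => i _; rewrite nu_mulmxE act_sumr.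
by apply: eq_bigr => k _; rewrite actMr.
Qed.

(** Three consecutive instances of the recurrence express the next three values of [u] through the
    last three, which is the action of the cube of the companion matrix. *)
Let rho_step n : (fun j : 'I_3 => rho n.+3 j) = apply_mx (fun j => rho n j) Z.
Proof.
have e3 := u_rec n; have e4 := u_rec n.+1; have e5 := u_rec n.+2.
apply/funext => j; rewrite /apply_mx !big_ord_recl big_ord0 !mxE addr0 /rho /=.
case: j => [[|[|[|j]]] hj] //=; rewrite /Zcol /= ?(subn0, subSS) ?addn2 ?addn1 ?addn0.
- by rewrite e5 e4 e3 !(actDl, actDr, actMr, act0r, act0l); ring.
- by rewrite e4 e3 !(actDl, actDr, actMr, act0r, act0l); ring.
- by rewrite e3 addrA.
Qed.

(** If a power of [Z] were zero, [u] would vanish from some index on. A path polynomial of that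
    length would then be zero, its lower coefficients vanishing because every factor is divisible by
    'X; but it is a product of non-zero polynomials. *)
Lemma companion_cube_not_nilpotent : exists X : nu_matrix A 3, ~ nilpotent_elt X.
Proof.
exists Z => -[n Zn].
have rho_iter k : (fun j : 'I_3 => rho (3 * k).+3 j) =
    apply_mx (fun j => rho 0 j) (iter k (fun Y => (Z * Y)%g) Z).
  elim: k => [|k IHk]; first exact: rho_step.
  have iterSr m : iter m.+1 (fun Y => (Z * Y)%g) Z = (iter m (fun Y => (Z * Y)%g) Z * Z)%g.
    by elim: m => // m IHm; rewrite [LHS]iterS [in LHS]IHm mulgA.
  rewrite mulnS rho_step [in LHS]IHk iterSr; apply/funext => j; exact: apply_mxM.
have rho0 k : (n <= k)%N -> (fun j : 'I_3 => rho (3 * k).+3 j) = (fun=> 0).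
  elim: k => [|k IHk].
    rewrite leqn0 => /eqP n0; rewrite rho_iter; apply/funext => j.
    by rewrite /apply_mx big1 // => i _; move: Zn; rewrite n0 => ->; rewrite mxE act0r.
  rewrite leq_eqVlt => /orP [/eqP nk|lt_nk].
    rewrite rho_iter -nk Zn; apply/funext => j.
    by rewrite /apply_mx big1 // => i _; rewrite mxE act0r.
  rewrite mulnS rho_step IHk //; apply/funext => j.
  by rewrite /apply_mx big1 // => i _; rewrite act0l.
have u0 k : (3 * n + 3 <= k)%N -> u k = 0.
  (* Division of [k - 3] by 3 locates [u k] as the component [2 - c] of a state vector that is known
     to vanish. *)
  move=> le_k; pose m := (k - 3)%N; pose c := (m %% 3)%N.
  have lt_c : (c < 3)%N by rewrite ltn_mod.
  have le_nm : (n <= m %/ 3)%N by rewrite leq_divRL // mulnC /m; lia.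
  have /(congr1 (fun f => f (inord (2 - c) : 'I_3))) := rho0 _ le_nm.
  rewrite /rho inordK; last by lia.
  have -> : ((3 * (m %/ 3)).+3 + (2 - (2 - c)) = k)%N by have := divn_eq m 3; rewrite -/c /m; lia.
  by [].
have path0 : pathpoly (3 * n + 3) = 0.
  apply/polyP => k; rewrite coef0; have [lt_k|le_k] := ltnP k (3 * n + 3).
    exact: pathpoly_low.
  by rewrite -coef_u u0 // coef0.
have : pathpoly (3 * n + 3) != 0 by apply/prodf_neq0 => i _; apply: weightpoly_neq0.
by rewrite path0 eqxx.
Qed.
End NotNilpotent.

Theorem theorem1p1 :
  (forall K : countClosedFieldType,
     exists (A : nuAlgType K) (A_ : nat -> {pred A}),
       [/\ positive_grading A_, fin_gen_degree_one A_,
           nil_on (predT : {pred A}) & admits_point_module A_])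
  /\
  (exists (R : nuRingType) (I J : {pred R}),
     [/\ left_ideal I, left_ideal J, nil_on I, nil_on J
       & ~ nil_on (ideal_sum I J)]).
Proof.
split=> [K|].
  have [zeta [zeta_neq0 nilA]] := countClosedField_nil_algebra K.
  exists (shift_algebra zeta), (@shift_part K zeta); split=> //.
  - exact: shift_grading.
  - exact: shift_fin_gen.
  - exists {poly K}, (@point_act K zeta), (@point_part K).
    exact: shift_point_module.
(* One countable algebraically closed field suffices here: the algebraic numbers. *)
have [zeta [zeta_neq0 nilA]] := countClosedField_nil_algebra algC.
have [X nX] := companion_cube_not_nilpotent zeta_neq0.
exact: koethe_of_matrices nilA nX.
Qed.
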